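(* Let $n\in\mathbb{Z}$ and let $A$ be an $\mathrm{SU}(3)$-invariant connection on the $S^1$-bundle $E_n\to X^*$ in temporal gauge, where $X^*=T^*\mathbb{CP}^2\setminus\mathbb{CP}^2$ carries the Calabi hyperkähler structure, so that $A=A_{n,0}+(p_0(r)\kappa+p_1(r)\nu_1+p_2(r)\nu_2)\otimes T$ for some functions $p_0,p_1,p_2:(1,\infty)\to\mathbb{R}$. Let $C_0,C_1,C_2\in\mathbb{R}$ denote the constants parametrizing the invariant $L$-$\mathrm{Spin}(7)$-instantons for each $L\in\{I,J,K\}$, as recalled in the context. Then: (a) $A$ is an $I$-$\mathrm{SU}(4)$-instanton if and only if $A$ is an $I$-$\mathrm{Spin}(7)$-instanton with $C_1=C_2=0$, i.e.: $$p_0(r)=-\frac{n}{r^2}\Big(1+\frac{C_0}{r^4-1}\Big),\quad p_1(r)=0,\quad p_2(r)=0.$$ (b) $A$ is a $J$-$\mathrm{SU}(4)$-instanton if and only if $A$ is a $J$-$\mathrm{Spin}(7)$-instanton with $C_0=C_1=0$, i.e.: $$p_0(r)=-\frac{n}{r^2},\quad p_1(r)=0,\quad p_2(r)=C_2(r^4-1)^{-3/2}.$$ (c) $A$ is a $K$-$\mathrm{SU}(4)$-instanton if and only if $A$ is a $K$-$\mathrm{Spin}(7)$-instanton with $C_0=C_2=0$, i.e.: $$p_0(r)=-\frac{n}{r^2},\quad p_1(r)=C_1(r^4-1)^{-3/2},\quad p_2(r)=0.$$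
   Context: **Calabi structure.** $\mathrm{SU}(3)$ acts on $X=T^*\mathbb{CP}^2$ in the standard way; $X^*$ is the complement of the zero section. Let $K_0=\{\mathrm{diag}(e^{i\theta},e^{i\theta},e^{-2i\theta})\}\cong\mathrm{U}(1)$ and $N_{1,1}=\mathrm{SU}(3)/K_0$. Write the left-invariant Maurer–Cartan form of $\mathrm{SU}(3)$ as $$\eta=\begin{bmatrix} i(\zeta+\kappa)&\nu&\sigma\\-\overline\nu&i(\zeta-\kappa)&\mu\\-\overline\sigma&-\overline\mu&-2i\zeta\end{bmatrix},\quad \nu=\nu_1+i\nu_2,\ \sigma=\sigma_1+i\sigma_2,\ \mu=\mu_1+i\mu_2,$$ which defines real left-invariant $1$-forms $\zeta,\kappa,\nu_j,\sigma_j,\mu_j$. The principal locus $X^*$ is identified $\mathrm{SU}(3)$-equivariantly with $(1,\infty)\times N_{1,1}$, with coordinate $r\in(1,\infty)$; forms on $X^*$ are identified with their pullbacks to $(1,\infty)\times\mathrm{SU}(3)$. Put $a=\sqrt{(r^2-1)/2}$, $b=\sqrt{(r^2+1)/2}$, $c=r$, $f=\frac1r\sqrt{r^4-1}$, $dt=\sqrt{r^4/(r^4-1)}\,dr$, and $e^0=dt$, $e^1=a\sigma_1$, $e^2=a\sigma_2$, $e^3=b\mu_1$, $e^4=b\mu_2$, $e^5=c\nu_1$, $e^6=c\nu_2$, $e^7=f\kappa$. The Calabi metric is $g=\sum_{j=0}^7(e^j)^2$, with orientation $e^{0}\wedge e^1\wedge\cdots\wedge e^7$ and Kähler forms ($e^{ij}=e^i\wedge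 e^j$) $$\omega_I=-e^{07}+e^{56}+e^{12}-e^{34},\quad \omega_J=-e^{06}-e^{57}-e^{23}+e^{14},\quad \omega_K=e^{05}-e^{67}+e^{24}+e^{13}.$$ Set $\Phi_I=\frac12(\omega_I^2+\omega_J^2-\omega_K^2)$, $\Phi_J=\frac12(-\omega_I^2+\omega_J^2+\omega_K^2)$, $\Phi_K=\frac12(\omega_I^2-\omega_J^2+\omega_K^2)$. For $L\in\{I,J,K\}$, a connection $A$ with curvature $F_A$ is an $L$-$\mathrm{Spin}(7)$-instanton if $\ast F_A=-\Phi_L\wedge F_A$, and an $L$-$\mathrm{SU}(4)$-instanton, also called primitive Hermitian Yang-Mills with respect to $L$, if $\ast F_A=-\frac12\omega_L^2\wedge F_A$. **Bundles and connections.** For $n\in\mathbb{Z}$ let $P_n=(\mathrm{SU}(3)\times S^1)/\!\sim$ with $(h,s)\sim(hz,sz^n)$ for $z\in\mathrm{U}(1)\cong K_0$ (via $e^{i\theta}\mapsto\mathrm{diag}(e^{i\theta},e^{i\theta},e^{-2i\theta})$), a principal $S^1$-bundle over $N_{1,1}$ with left $\mathrm{SU}(3)$-action and right $S^1$-action $[h,s]\cdot s'=[h,s'^{-1}s]$; $E_n=(1,\infty)\times P_n\to X^*$ is its pullback to $X^*$. $T$ is the standard basis vector of $\mathrm{Lie}(S^1)$. A connection on $E_n$ is in temporal gauge if its connection form has no $dr$ component; it is identified with its pullback to $(1,\infty)\times\mathrm{SU}(3)$ under $(r,h)\mapsto(r,[h,1])$. The canonical connection is $A_{n,0}=n\zeta\otimes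 T$. $\mathrm{SU}(3)$-invariant connections in temporal gauge are exactly those of the form displayed in the claim. **The constants $C_0,C_1,C_2$.** In the same work the invariant $L$-$\mathrm{Spin}(7)$-instantons in temporal gauge on $E_n$ are parametrized by constants $C_0,C_1,C_2\in\mathbb{R}$ (the same letters being reused for the three cases) as follows. For $L=I$: $p_0=-\frac{n}{r^2}\big(1+\frac{C_0}{r^4-1}\big)$, $p_1=C_1(r^4-1)^{1/2}$, $p_2=C_2(r^4-1)^{-3/2}$. For $L=J$: $p_0=-\frac{n}{r^2}+C_0\frac{1-r^4}{r^2}$, $p_1=C_1(r^4-1)^{-3/2}$, $p_2=C_2(r^4-1)^{-3/2}$. For $L=K$: $p_0=-\frac{n}{r^2}\big(1+\frac{C_0}{r^4-1}\big)$, $p_1=C_1(r^4-1)^{-3/2}$, $p_2=C_2(r^4-1)^{1/2}$.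
   Formalization: Claim (a) fails for n=0, where p_0=C/(r^2(r^4-1)), p_1=p_2=0 are also I-SU(4)-instantons; it is proved as written for n≠0, and for every n with p_0=-(1/r^2)(n+C_0/(r^4-1)), i.e. with nC_0 replaced by C_0 in the family. *)

(* Defs.v *)
From HB Require Import structures.
From mathcomp Require Import all_boot all_order all_algebra.
From mathcomp Require Import complex ring lra.
From mathcomp Require Import all_classical all_reals all_analysis.

Set Implicit Arguments.
Unset Strict Implicit.
Unset Printing Implicit Defensive.

Import Order.TTheory GRing.Theory Num.Theory.
Import numFieldNormedType.Exports.
Local Open Scope ring_scope.
Local Open Scope sesquilinear_scope.

(* A form is the family of its coefficients on the monomials
   e^S = e^{i_1} /\ ... /\ e^{i_k}, S = {i_1 < ... < i_k}. *)
Definition ext (R : realType) (n : nat) := {ffun {set 'I_n} -> R^o}.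

(* e^S /\ e^T = wsign S T * e^(S u T) when S and T are disjoint. *)
Definition wsign (R : realType) n (S T : {set 'I_n}) : R :=
  (-1) ^+ #|[set p in finset.setX S T | (p.2 < p.1)%N]|.

Definition wedge (R : realType) n (a b : ext R n) : ext R n :=
  [ffun U : {set 'I_n} => \sum_(S in powerset U)
     wsign R S (U :\: S) * a S * b (U :\: S)].

Definition covec (R : realType) n (i : 'I_n) : ext R n :=
  [ffun S : {set 'I_n} => (S == finset.set1 i)%:R].

(* Hodge star for the metric in which the e^i are orthonormal and the
   orientation e^0 /\ ... /\ e^(n-1): it sends e^T to wsign T T^c * e^(T^c). *)
Definition hodge (R : realType) n (a : ext R n) : ext R n :=
  [ffun S : {set 'I_n} => wsign R (finset.setC S) S * a (finset.setC S)].

Inductive hkindex := LI | LJ | LK.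

Definition e2 (R : realType) (i j : 'I_8) : ext R 8 :=
  wedge (covec R i) (covec R j).

Definition omega (R : realType) (L : hkindex) : ext R 8 :=
  match L with
  | LI => - e2 R 0 7 + e2 R 5 6 + e2 R 1 2 - e2 R 3 4
  | LJ => - e2 R 0 6 - e2 R 5 7 - e2 R 2 3 + e2 R 1 4
  | LK => e2 R 0 5 - e2 R 6 7 + e2 R 2 4 + e2 R 1 3
  end.

Definition omega_sq (R : realType) (L : hkindex) : ext R 8 :=
  wedge (omega R L) (omega R L).

Definition Phi (R : realType) (L : hkindex) : ext R 8 :=
  match L with
  | LI => (2^-1 : R) *: (omega_sq R LI + omega_sq R LJ - omega_sq R LK)
  | LJ => (2^-1 : R) *: (- omega_sq R LI + omega_sq R LJ + omega_sq R LK)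
  | LK => (2^-1 : R) *: (omega_sq R LI - omega_sq R LJ + omega_sq R LK)
  end.

Definition SU3 (R : realType) (h : 'M[R[i]]_3) : Prop :=
  h \is unitarymx /\ \det h = 1.

Definition su3 (R : realType) (X : 'M[R[i]]_3) : Prop :=
  X ^t* = - X /\ \tr X = 0.

(* The tangent space of SU(3) at h is { h X | X in su(3) }; throughout, the
   tangent vector h X is represented by X, so that the Maurer-Cartan form is
   the identity. The matrix of the Maurer-Cartan form with the given entries: *)
Definition mcmx (R : realType) (z k : R) (nu sg mu : R[i]) : 'M[R[i]]_3 :=
  let rows := [:: [:: (0 +i* (z + k))%C;  nu;                 sg ];
                  [:: - nu^*%C;           (0 +i* (z - k))%C;  mu ];
                  [:: - sg^*%C;           - mu^*%C;           (0 +i* (- (2 * z)))%C ]]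
  in \matrix_(i < 3, j < 3) nth 0 (nth [::] rows i) j.

Definition zeta (R : realType) (X : 'M[R[i]]_3) : R := - complex.Im (X 2 2) / 2.
Definition kappa (R : realType) (X : 'M[R[i]]_3) : R :=
  (complex.Im (X 0 0) - complex.Im (X 1 1)) / 2.
Definition nu1 (R : realType) (X : 'M[R[i]]_3) : R := complex.Re (X 0 1).
Definition nu2 (R : realType) (X : 'M[R[i]]_3) : R := complex.Im (X 0 1).
Definition sigma1 (R : realType) (X : 'M[R[i]]_3) : R := complex.Re (X 0 2).
Definition sigma2 (R : realType) (X : 'M[R[i]]_3) : R := complex.Im (X 0 2).
Definition mu1 (R : realType) (X : 'M[R[i]]_3) : R := complex.Re (X 1 2).
Definition mu2 (R : realType) (X : 'M[R[i]]_3) : R := complex.Im (X 1 2).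

Definition K0elt (R : realType) (z : R[i]) : 'M[R[i]]_3 :=
  diag_mx (\row_(j < 3) nth 0 [:: z; z; z ^- 2] j).

(* The derivative of e^(i t) |-> K0elt (e^(i t)) at t = 0. *)
Definition K0gen (R : realType) : 'M[R[i]]_3 :=
  diag_mx (\row_(j < 3) nth 0 [:: 'i%C; 'i%C; - 2 * 'i%C] j).

(* Left-trivialized tangent vectors of (1, oo) x SU(3): (rho, X) stands for
   rho d/dr + h X at (r, h). *)
Definition tvec (R : realType) := (R * 'M[R[i]]_3)%type.

Definition cal_a (R : realType) (r : R) : R := Num.sqrt ((r ^+ 2 - 1) / 2).
Definition cal_b (R : realType) (r : R) : R := Num.sqrt ((r ^+ 2 + 1) / 2).
Definition cal_c (R : realType) (r : R) : R := r.
Definition cal_f (R : realType) (r : R) : R := r^-1 * Num.sqrt (r ^+ 4 - 1).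
Definition cal_dt (R : realType) (r : R) : R :=
  Num.sqrt (r ^+ 4 / (r ^+ 4 - 1)).

Definition coframe (R : realType) (r : R) (j : 'I_8) (v : tvec R) : R :=
  nth 0 [:: cal_dt r * v.1;
            cal_a r * sigma1 v.2; cal_a r * sigma2 v.2;
            cal_b r * mu1 v.2;    cal_b r * mu2 v.2;
            cal_c r * nu1 v.2;    cal_c r * nu2 v.2;
            cal_f r * kappa v.2] j.

(* The lift of the frame dual to e^0, ..., e^7 on which zeta vanishes. *)
Definition frame (R : realType) (r : R) (j : 'I_8) : tvec R :=
  nth (0, 0) [:: ((cal_dt r)^-1, 0);
    (0, mcmx 0 0 0 ((cal_a r)^-1 +i* 0)%C 0);
    (0, mcmx 0 0 0 (0 +i* (cal_a r)^-1)%C 0);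
    (0, mcmx 0 0 0 0 ((cal_b r)^-1 +i* 0)%C);
    (0, mcmx 0 0 0 0 (0 +i* (cal_b r)^-1)%C);
    (0, mcmx 0 0 ((cal_c r)^-1 +i* 0)%C 0 0);
    (0, mcmx 0 0 (0 +i* (cal_c r)^-1)%C 0 0);
    (0, mcmx 0 (cal_f r)^-1 0 0 0)] j.

Definition smooth_gt1 (R : realType) (f : R -> R) : Prop :=
  forall (k : nat) (r : R), 1 < r -> derivable (derive1n k f) r 1.

(* A 1-form on (1, oo) x SU(3) x S^1, left-trivialized: (rho, X, tau) stands
   for rho d/dr + h X + tau (i s) at (r, h, s). *)
Definition form1E (R : realType) :=
  R -> 'M[R[i]]_3 -> R[i] -> R * 'M[R[i]]_3 * R -> R.

(* An SU(3)-invariant connection on the S^1-bundle E_n, given by the pullback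
   of its connection form (the coefficient of T) to (1, oo) x SU(3) x S^1,
   whose quotient by the right action (h, s) . z = (h z, s z^n) of K_0 is E_n.
   Pullbacks from that quotient are the forms satisfying [ic_K0] and
   [ic_basic]. The structure group acts by [h, s] . s' = [h, s'^-1 s], whence
   the signs in [ic_vert] and [ic_S1]. By invariance, smoothness reduces to
   smoothness in r. *)
Record invariant_connection (R : realType) (n : int) (A : form1E R) : Prop := {
  ic_linear : forall r h s (c x x' : R) (X X' : 'M[R[i]]_3) (t t' : R),
    1 < r -> SU3 h -> `|s| = 1 -> su3 X -> su3 X' ->
    A r h s (c * x + x', c%:C%C *: X + X', c * t + t') =
    c * A r h s (x, X, t) + A r h s (x', X', t');
  ic_smooth : forall h s x (X : 'M[R[i]]_3) t,
    SU3 h -> `|s| = 1 -> su3 X -> smooth_gt1 (fun r => A r h s (x, X, t));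
  ic_K0 : forall r h s z x (X : 'M[R[i]]_3) t,
    1 < r -> SU3 h -> `|s| = 1 -> `|z| = 1 -> su3 X ->
    A r (h *m K0elt z) (s * z ^ n) (x, invmx (K0elt z) *m X *m K0elt z, t) =
    A r h s (x, X, t);
  ic_basic : forall r h s,
    1 < r -> SU3 h -> `|s| = 1 -> A r h s (0, K0gen R, n%:~R) = 0;
  ic_vert : forall r h s,
    1 < r -> SU3 h -> `|s| = 1 -> A r h s (0, 0, -1) = 1;
  ic_S1 : forall r h s s' x (X : 'M[R[i]]_3) t,
    1 < r -> SU3 h -> `|s| = 1 -> `|s'| = 1 -> su3 X ->
    A r h (s'^-1 * s) (x, X, t) = A r h s (x, X, t);
  ic_SU3 : forall r g h s x (X : 'M[R[i]]_3) t,
    1 < r -> SU3 g -> SU3 h -> `|s| = 1 -> su3 X ->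
    A r (g *m h) s (x, X, t) = A r h s (x, X, t) }.

Definition temporal_gauge (R : realType) (A : form1E R) : Prop :=
  forall r h s, 1 < r -> SU3 h -> `|s| = 1 -> A r h s (1, 0, 0) = 0.

(* Pullback along (r, h) |-> (r, [h, 1]). *)
Definition pullA (R : realType) (A : form1E R) (r : R) (h : 'M[R[i]]_3)
    (v : tvec R) : R := A r h 1 (v.1, v.2, 0).

(* F_A = dA, by dA(V, W) = V(A(W)) - W(A(V)) - A([V, W]) on the vector fields
   V = v.1 d/dr + h v.2, W = w.1 d/dr + h w.2, whose bracket is the left
   invariant field of the matrix commutator. Left invariance of A makes
   A(V), A(W) functions of r alone, so only their r-derivatives appear. *)
Definition curvature (R : realType) (A : form1E R) (r : R) (h : 'M[R[i]]_3)
    (v w : tvec R) : R :=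
  v.1 * derive1 (fun t => pullA A t h w) r
  - w.1 * derive1 (fun t => pullA A t h v) r
  - pullA A r h (0, v.2 *m w.2 - w.2 *m v.2).

(* The curvature as a 2-form on X^*, in the coframe e^0, ..., e^7. *)
Definition curvature_form (R : realType) (A : form1E R) (r : R)
    (h : 'M[R[i]]_3) : ext R 8 :=
  \sum_(i < 8) \sum_(j < 8 | (i < j)%N)
    (curvature A r h (frame r i) (frame r j) : R) *: e2 R i j.

Definition spin7_instanton (R : realType) (L : hkindex) (A : form1E R) : Prop :=
  forall r h, 1 < r -> SU3 h ->
    hodge (curvature_form A r h) = - wedge (Phi R L) (curvature_form A r h).

Definition su4_instanton (R : realType) (L : hkindex) (A : form1E R) : Prop :=
  forall r h, 1 < r -> SU3 h ->
    hodge (curvature_form A r h) =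
    - wedge ((2^-1 : R) *: omega_sq R L) (curvature_form A r h).

(* A = A_{n,0} + (p0 kappa + p1 nu_1 + p2 nu_2) (x) T on (1, oo) x SU(3). *)
Definition has_coeffs (R : realType) (n : int) (A : form1E R)
    (p0 p1 p2 : R -> R) : Prop :=
  forall r h (v : tvec R), 1 < r -> SU3 h -> su3 v.2 ->
    pullA A r h v =
    n%:~R * zeta v.2
    + (p0 r * kappa v.2 + p1 r * nu1 v.2 + p2 r * nu2 v.2).

Definition spin7_family (R : realType) (L : hkindex) (n : int)
    (C0 C1 C2 : R) (p0 p1 p2 : R -> R) : Prop :=
  forall r, 1 < r ->
  match L with
  | LI => [/\ p0 r = - (n%:~R / r ^+ 2) * (1 + C0 / (r ^+ 4 - 1)),
              p1 r = C1 * (r ^+ 4 - 1) `^ (1 / 2)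
            & p2 r = C2 * (r ^+ 4 - 1) `^ (- (3 / 2))]
  | LJ => [/\ p0 r = - (n%:~R / r ^+ 2) + C0 * ((1 - r ^+ 4) / r ^+ 2),
              p1 r = C1 * (r ^+ 4 - 1) `^ (- (3 / 2))
            & p2 r = C2 * (r ^+ 4 - 1) `^ (- (3 / 2))]
  | LK => [/\ p0 r = - (n%:~R / r ^+ 2) * (1 + C0 / (r ^+ 4 - 1)),
              p1 r = C1 * (r ^+ 4 - 1) `^ (- (3 / 2))
            & p2 r = C2 * (r ^+ 4 - 1) `^ (1 / 2)]
  end.

(* [spin7_family LI] with n C0 replaced by C0: the same family when n <> 0,
   whereas for n = 0 the former forces p0 = 0 and so misses the instantons
   p0 = - C0 / (r^2 (r^4 - 1)). *)
Definition spin7_family_I (R : realType) (n : int)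
    (C0 C1 C2 : R) (p0 p1 p2 : R -> R) : Prop :=
  forall r, 1 < r ->
  [/\ p0 r = - (1 / r ^+ 2) * (n%:~R + C0 / (r ^+ 4 - 1)),
      p1 r = C1 * (r ^+ 4 - 1) `^ (1 / 2)
    & p2 r = C2 * (r ^+ 4 - 1) `^ (- (3 / 2))].

Lemma mcmx_coords (R : realType) (X : 'M[R[i]]_3) : su3 X ->
  mcmx (zeta X) (kappa X) (nu1 X +i* nu2 X)%C (sigma1 X +i* sigma2 X)%C
    (mu1 X +i* mu2 X)%C = X.
Proof.
case=> hX tX.
have hE (k l : 'I_3) : (X l k)^*%C = - X k l
  by have := congr1 (fun M : 'M[R[i]]_3 => M k l) hX; rewrite !mxE.
have dE i : complex.Re (X i i) = 0.
  have /(congr1 (@complex.Re R)) := hE i i; case: (X i i) => a b /=.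
  by move=> ha; lra.
have oE i j : - (X j i)^*%C = X i j.
  by rewrite hE opprK.
have tE : complex.Im (X 0 0) + complex.Im (X 1 1) + complex.Im (X 2 2) = 0.
  move: tX; rewrite /mxtrace !big_ord_recl big_ord0 => tX.
  have := congr1 (@complex.Im R) tX; rewrite !raddfD /= addr0 addrA.
  have -> : lift ord0 (lift ord0 ord0) = 2 :> 'I_3 by exact: val_inj.
  by have -> : lift ord0 ord0 = 1 :> 'I_3 by exact: val_inj.
have pE (z : R[i]) : (complex.Re z +i* complex.Im z)%C = z by case: z.
have iE (z : R[i]) y : complex.Re z = 0 -> complex.Im z = y -> (0 +i* y)%C = z.
  by case: z => a b /= -> ->.
apply/matrixP => i j; rewrite !mxE /nu1 /nu2 /sigma1 /sigma2 /mu1 /mu2 !pE !oE.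
have ord3 : forall k : 'I_3, [\/ k = 0, k = 1 | k = 2].
  case=> [[|[|[|//]]]] hk; [constructor 1|constructor 2|constructor 3];
  exact: val_inj.
case: (ord3 i) => ->; case: (ord3 j) => -> //=; apply: iE => //;
  rewrite /zeta /kappa; move: tE; lra.
Qed.

Lemma coframe_frame (R : realType) (r : R) (i j : 'I_8) : 1 < r ->
  coframe r i (frame r j) = (i == j)%:R.
Proof.
move=> r1; have r0 : 0 < r by apply: lt_trans r1.
have r2 : 1 < r ^+ 2 by rewrite exprn_egt1.
have r4 : 0 < r ^+ 4 - 1 by rewrite subr_gt0 exprn_egt1.
have a0 : cal_a r != 0.
  by rewrite gt_eqF// sqrtr_gt0 divr_gt0// subr_gt0.
have b0 : cal_b r != 0.
  by rewrite gt_eqF// sqrtr_gt0 divr_gt0// addr_gt0// exprn_gt0.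
have c0 : cal_c r != 0 by rewrite gt_eqF.
have f0 : cal_f r != 0.
  by rewrite gt_eqF// mulr_gt0 ?invr_gt0// sqrtr_gt0.
have d0 : cal_dt r != 0.
  by rewrite gt_eqF// sqrtr_gt0 divr_gt0// exprn_gt0.
case: i => [[|[|[|[|[|[|[|[|//]]]]]]]] hi];
case: j => [[|[|[|[|[|[|[|[|//]]]]]]]] hj];
rewrite /coframe /frame /sigma1 /sigma2 /mu1 /mu2 /nu1 /nu2 /kappa /= ?mxE /=;
  rewrite ?mulr0 ?oppr0 ?mulfV //.
all: rewrite ?raddf0 ?subrr ?mul0r ?mulr0 //.
all: by field.
Qed.

Lemma smooth_gt1D (R : realType) (a : R) (f g : R -> R) :
  smooth_gt1 f -> smooth_gt1 g -> smooth_gt1 (fun r => a * f r + g r).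
Proof.
move=> sf sg.
have near1 (r : R) : 1 < r -> \forall t \near r, 1 < t.
  by move=> r1; exact: lt_nbhsr.
have E k : forall r, 1 < r -> derive1n k (fun r => a * f r + g r) r =
    a * derive1n k f r + derive1n k g r.
  elim: k => [//|k IH] r r1.
  rewrite !derive1nS !derive1E.
  have -> : 'D_1 (derive1n k (fun r => a * f r + g r)) r =
      'D_1 (a \*: derive1n k f + derive1n k g) r.
    apply: near_eq_derive.
    by near=> t; rewrite IH//; near: t; exact: near1.
  have df := sf k r r1; have dg := sg k r r1.
  by rewrite deriveD ?deriveZ//; exact: derivableZ.
move=> k r r1.
have D : derivable (a \*: derive1n k f + derive1n k g) r 1.
  by apply: derivableD; [apply: derivableZ; exact: sf | exact: sg].
apply: near_eq_derivable D.
by near=> t; rewrite E//; near: t; exact: near1.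
Unshelve. all: by end_near.
Qed.

Lemma smooth_gt1_cst (R : realType) (a : R) : smooth_gt1 (fun=> a).
Proof.
have E k : derive1n k (fun=> a : R) = fun=> if k is 0%N then a else 0.
  by elim: k => // k IH; apply/funext => r; rewrite derive1nS IH derive1_cst.
by move=> k r _; rewrite E; exact: derivable_cst.
Qed.

Lemma invmx_K0elt (R : realType) (z : R[i]) : `|z| = 1 ->
  invmx (K0elt z) = K0elt z^-1.
Proof.
move=> z1; have z0 : z != 0 by rewrite -normr_eq0 z1 oner_neq0.
have K1 : K0elt z^-1 *m K0elt z = 1%:M.
  rewrite mulmx_diag; apply/matrixP => i j; rewrite !mxE.
  case: i => [[|[|[|//]]]] hi /=; rewrite ?mulVf// exprVn invrK mulfV//.
  by rewrite expf_neq0.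
have [_ U] := mulmx1_unit K1.
by rewrite -[RHS]mulmx1 -(mulmxV U) mulmxA K1 mul1mx.
Qed.

Lemma invariant_connectionP (R : realType) (n : int) (p0 p1 p2 : R -> R) :
  smooth_gt1 p0 -> smooth_gt1 p1 -> smooth_gt1 p2 ->
  let A : form1E R := fun r _ _ v =>
    n%:~R * zeta v.1.2
    + (p0 r * kappa v.1.2 + p1 r * nu1 v.1.2 + p2 r * nu2 v.1.2) - v.2 in
  [/\ invariant_connection n A, temporal_gauge A & has_coeffs n A p0 p1 p2].
Proof.
move=> s0 s1 s2 A.
have R0 : zeta 0 = 0 :> R by rewrite /zeta mxE /= oppr0 mul0r.
have R1 : kappa 0 = 0 :> R by rewrite /kappa !mxE /= subr0 mul0r.
have R2 : nu1 0 = 0 :> R by rewrite /nu1 mxE.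
have R3 : nu2 0 = 0 :> R by rewrite /nu2 mxE.
split; last 2 first.
- by move=> r h s _ _ _; rewrite /A /= R0 R1 R2 R3 !mulr0 !addr0 subr0.
- by move=> r h v _ _ _; rewrite /pullA /A /= subr0.
split=> //.
- move=> r h s c x x' X X' t t' *; rewrite /A /= /zeta /kappa /nu1 /nu2 !mxE.
  have C z w : complex.Re (c%:C%C * z + w) = c * complex.Re z + complex.Re w.
    by case: z => ? ?; case: w => ? ? /=; rewrite mul0r subr0.
  have D z w : complex.Im (c%:C%C * z + w) = c * complex.Im z + complex.Im w.
    by case: z => ? ?; case: w => ? ? /=; rewrite mul0r addr0.
  by rewrite !C !D; field.
- move=> h s x X t _ _ _; rewrite /A /=.
  have -> : (fun r => n%:~R * zeta X +
      (p0 r * kappa X + p1 r * nu1 X + p2 r * nu2 X) - t) =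
    (fun r => kappa X * p0 r + (nu1 X * p1 r + (nu2 X * p2 r +
      (n%:~R * zeta X - t)))) by apply/funext => r; ring.
  by do 3![apply: smooth_gt1D => //]; exact: smooth_gt1_cst.
- move=> r h s z x X t _ _ _ z1 _; rewrite /A /= (invmx_K0elt z1).
  have z0 : z != 0 by rewrite -normr_eq0 z1 oner_neq0.
  have E i j : (K0elt z^-1 *m X *m K0elt z) i j =
     nth 0 [:: z^-1; z^-1; z^-1 ^- 2] i * X i j * nth 0 [:: z; z; z ^- 2] j.
    by rewrite mul_mx_diag mul_diag_mx !mxE.
  have E1 (i j : 'I_3) : (i < 2)%N = (j < 2)%N -> (K0elt z^-1 *m X *m K0elt z) i j = X i j.
    rewrite E; case: i => [[|[|[|//]]]] hi; case: j => [[|[|[|//]]]] hj //= _;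
    by rewrite [_ * X _ _]mulrC -mulrA -?exprVn -?exprMn ?invrK
         ?mulVf ?mulfV ?expr1n ?mulr1.
  by rewrite /zeta /kappa /nu1 /nu2 !E1.
- move=> r h s *; rewrite /A /= /zeta /kappa /nu1 /nu2 !mxE /=.
  by field.
- by move=> r h s *; rewrite /A /= R0 R1 R2 R3; ring.
Qed.

(* The curvature is horizontal, so its components in the frame determine it. *)
Lemma curvature_K0gen (R : realType) (n : int) (A : form1E R)
    (p0 p1 p2 : R -> R) r h (w : tvec R) :
  has_coeffs n A p0 p1 p2 -> 1 < r -> SU3 h -> su3 w.2 ->
  curvature A r h (0, K0gen R) w = 0.
Proof.
move=> hA r1 hh [wT wtr].
have KT : (K0gen R) ^t* = - K0gen R.
  apply/matrixP => i j; rewrite !mxE eq_sym raddfMn /=.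
  have [->|_] := eqVneq i j; last by rewrite !mulr0n oppr0.
  case: j => [[|[|[|//]]]] hj /=; rewrite !mulr1n; apply/eqP;
  by rewrite eq_complex /=; apply/andP; split; apply/eqP; ring.
have su3K : su3 (K0gen R).
  split=> //; rewrite mxtrace_diag !big_ord_recl big_ord0 !mxE /=; ring.
have su3B : su3 (K0gen R *m w.2 - w.2 *m K0gen R).
  split; last by rewrite raddfB /= mxtrace_mulC subrr.
  rewrite linearB /= map_mxB !trmx_mul !map_mxM /= wT KT.
  by rewrite !mulNmx !mulmxN !opprK opprB.
rewrite /curvature /= mul0r add0r.
have -> : derive1 (fun t => pullA A t h (0, K0gen R)) r = 0.
  rewrite derive1E; transitivity ('D_1 (cst (n%:~R : R)) r); last exact: derive_cst.
  apply: near_eq_derive; near=> t.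
  rewrite hA//; last by near: t; exact: lt_nbhsr.
  by rewrite /zeta /kappa /nu1 /nu2 !mxE /=; field.
rewrite mulr0 oppr0 sub0r hA//= /zeta /kappa /nu1 /nu2.
have E i j : (K0gen R *m w.2 - w.2 *m K0gen R) i j =
    nth 0 [:: 'i%C; 'i%C; - 2 * 'i%C] i * w.2 i j
    - w.2 i j * nth 0 [:: 'i%C; 'i%C; - 2 * 'i%C] j.
  by rewrite mul_mx_diag mul_diag_mx !mxE.
rewrite !E /= ![_ * w.2 _ _]mulrC !subrr /=; ring.
Unshelve. all: by end_near.
Qed.

(* Main.v *)
Require Import Defs.
From HB Require Import structures.
From mathcomp Require Import all_boot all_order all_algebra.
From mathcomp Require Import complex ring lra.
From mathcomp Require Import all_classical all_reals all_analysis.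

Set Implicit Arguments.
Unset Strict Implicit.
Unset Printing Implicit Defensive.

Import Order.TTheory GRing.Theory Num.Theory.
Import numFieldNormedType.Exports.
Local Open Scope ring_scope.

(* In temporal gauge F_A = dA involves only the twelve monomials e^{ij} that
   occur in the Kaehler forms, and the instanton equation decouples into
   linear conditions on the coefficients of the three blocks of four. For
   L-SU(4)-instantons the block of omega_L gives one condition, F . omega_L = 0,
   and each of the other two blocks gives two. With F_A inserted, the block of
   p1 (resp. p2), if it is not that of omega_L, forces p1 = 0 (resp. p2 = 0); the
   block of p0, if it is not that of omega_L, forces p0 = -n/r^2; and F . omega_L = 0
   is a first order linear equation for the remaining function, with
   integrating factor r^2 (r^4 - 1) or (r^4 - 1)^(3/2). *)

(** * The exterior algebra on bit strings *)

Definition mono (R : realType) n (S : {set 'I_n}) : ext R n :=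
  [ffun T : {set 'I_n} => (T == S)%:R].

Section Wedge.
Context (R : realType) (n : nat).
Implicit Types (S T U : {set 'I_n}) (a b c : ext R n) (x : R).

Lemma wedgeDl a b c : wedge (a + b) c = wedge a c + wedge b c.
Proof.
apply/ffunP => U; rewrite !ffunE -big_split; apply: eq_bigr => S _ /=.
by rewrite ffunE mulrDr mulrDl.
Qed.

Lemma wedgeDr a b c : wedge a (b + c) = wedge a b + wedge a c.
Proof.
apply/ffunP => U; rewrite !ffunE -big_split; apply: eq_bigr => S _ /=.
by rewrite ffunE mulrDr.
Qed.

Lemma wedgeZl x a b : wedge (x *: a) b = x *: wedge a b.
Proof.
apply/ffunP => U; rewrite !ffunE scaler_sumr; apply: eq_bigr => S _ /=.
by rewrite !ffunE /GRing.scale /=; ring.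
Qed.

Lemma wedgeZr x a b : wedge a (x *: b) = x *: wedge a b.
Proof.
apply/ffunP => U; rewrite !ffunE scaler_sumr; apply: eq_bigr => S _ /=.
by rewrite !ffunE /GRing.scale /=; ring.
Qed.

Lemma wedge0l a : wedge 0 a = 0.
Proof. by rewrite -[0 in LHS](scale0r 0) wedgeZl scale0r. Qed.

Lemma wedge0r a : wedge a 0 = 0.
Proof. by rewrite -[0 in LHS](scale0r 0) wedgeZr scale0r. Qed.

Lemma wedge_suml I (r : seq I) (F : I -> ext R n) b :
  wedge (\sum_(i <- r) F i) b = \sum_(i <- r) wedge (F i) b.
Proof.
elim: r => [|i r IH]; first by rewrite !big_nil wedge0l.
by rewrite !big_cons wedgeDl IH.
Qed.

Lemma wedge_sumr I (r : seq I) (F : I -> ext R n) b :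
  wedge b (\sum_(i <- r) F i) = \sum_(i <- r) wedge b (F i).
Proof.
elim: r => [|i r IH]; first by rewrite !big_nil wedge0r.
by rewrite !big_cons wedgeDr IH.
Qed.

Lemma hodgeD a b : hodge (a + b) = hodge a + hodge b.
Proof. by apply/ffunP => U; rewrite !ffunE mulrDr. Qed.

Lemma hodgeZ x a : hodge (x *: a) = x *: hodge a.
Proof. by apply/ffunP => U; rewrite !ffunE /GRing.scale /=; ring. Qed.

Lemma hodge_sum I (r : seq I) (F : I -> ext R n) :
  hodge (\sum_(i <- r) F i) = \sum_(i <- r) hodge (F i).
Proof.
elim: r => [|i r IH]; last by rewrite !big_cons hodgeD IH.
by rewrite !big_nil -[0 in LHS](scale0r 0) hodgeZ scale0r.
Qed.

Lemma covecE (i : 'I_n) : covec R i = mono R (finset.set1 i).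
Proof. by []. Qed.

(** In the sum over the parts of [U] only the part [S] can contribute, and it does when its
    complement in [U] is [T]. [key] turns this into disjointness together with [U = S :|: T]. *)
Lemma wedge_mono S T : wedge (mono R S) (mono R T) =
  if [disjoint S & T] then wsign R S T *: mono R (S :|: T) else 0.
Proof.
apply/ffunP => U; rewrite ffunE.
have key : (S \subset U) && (U :\: S == T) = [disjoint S & T] && (U == S :|: T).
  apply/andP/andP => [[SU /eqP <-]|[dST /eqP ->]]; split.
  - by rewrite disjoint_sym finset.disjoints_subset finset.subsetDr.
  - apply/eqP/finset.setP => x; rewrite !inE.
    by case: (boolP (x \in S)) => // /(fintype.subsetP SU) ->.
  - exact: finset.subsetUl.
  - rewrite finset.setDUl finset.setDv finset.set0U; apply/eqP/finset.setDidPl.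
    by rewrite disjoint_sym.
transitivity (if (S \subset U) && (U :\: S == T) then wsign R S T else 0).
  case: ifP => [/andP[SU /eqP UT]|nST].
    rewrite (bigD1 S) ?powersetE//= !ffunE UT !eqxx !mulr1 big1 ?addr0// => S'.
    by move=> /andP[_ /negPf SS']; rewrite !ffunE SS' mulr0 mul0r.
  apply: big1 => S'; rewrite powersetE !ffunE => SU.
  have [SS|_] := eqVneq S' S; last by rewrite mulr0 mul0r.
  by move: nST; rewrite -SS SU /= => ->; rewrite mulr0.
rewrite key; case: [disjoint S & T] => /=; last by rewrite ffunE.
by rewrite !ffunE /GRing.scale /=; case: eqP; rewrite ?mulr1 ?mulr0.
Qed.

Lemma hodge_mono S : hodge (mono R S) = wsign R S (~: S) *: mono R (~: S).
Proof.
apply/ffunP => U; rewrite !ffunE /GRing.scale /=.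
have -> : (finset.setC U == S) = (U == ~: S).
  by apply/eqP/eqP => [<-|->]; rewrite finset.setCK.
by case: eqP => [->|]; rewrite ?finset.setCK ?mulr0.
Qed.

End Wedge.

(* Subsets of [{0, ..., n-1}] as bit strings, on which the exterior algebra
   computes. *)
Definition bits n (l : seq bool) : {set 'I_n} := [set i : 'I_n | nth false l i].

(** The exponent of [wsign]: pairs [j < i] with bit [i] set in [l] and bit [j] set in [m]. The
    leading bit of [m] is inverted with every set bit in the tail of [l]; the leading bit of [l] is
    inverted with none. *)
Fixpoint inversions (l m : seq bool) : nat :=
  match l, m with
  | _ :: l', y :: m' => (y * count id l' + inversions l' m')%N
  | _, _ => 0%N
  end.

Section Bits.
Context (R : realType) (n : nat).
Implicit Types (l m : seq bool).

Lemma bits_ex (S : {set 'I_n}) : exists2 l, size l = n & S = bits n l.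
Proof.
exists [seq i \in S | i <- enum 'I_n]; first by rewrite size_map size_enum_ord.
apply/finset.setP => i; rewrite inE (nth_map i) ?size_enum_ord//.
by rewrite nth_ord_enum.
Qed.

(** Missing bits are read as [false] by [nth], and bits from position [n] on are invisible to
    [bits]; fixing the length removes both ambiguities. *)
Lemma bits_inj l m : size l = n -> size m = n ->
  (bits n l == bits n m) = (l == m).
Proof.
move=> sl sm; apply/eqP/eqP => [lm|->//].
apply: (@eq_from_nth _ false) => [|i]; first by rewrite sl sm.
rewrite sl => i_n; move/finset.setP: lm => /(_ (Ordinal i_n)).
by rewrite !inE.
Qed.

Lemma bits_setC l : size l = n -> ~: bits n l = bits n (map negb l).
Proof.
move=> sl; apply/finset.setP => i; rewrite !inE (nth_map false) ?sl//.
Qed.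

Definition bor l m := [seq p.1 || p.2 | p <- zip l m].
Definition bdisj l m := all (fun p => ~~ (p.1 && p.2)) (zip l m).

Lemma bits_setU l m : size l = n -> size m = n ->
  bits n l :|: bits n m = bits n (bor l m).
Proof.
move=> sl sm; apply/finset.setP => i; rewrite !inE.
rewrite (nth_map (false, false)) ?size_zip ?sl ?sm ?minnn//.
by rewrite nth_zip ?sl.
Qed.

Lemma size_bor l m : size l = n -> size m = n -> size (bor l m) = n.
Proof. by move=> sl sm; rewrite size_map size_zip sl sm minnn. Qed.

Lemma bits_disjoint l m : size l = n -> size m = n ->
  [disjoint bits n l & bits n m] = bdisj l m.
Proof.
move=> sl sm; rewrite finset.disjoints_subset.
apply/fintype.subsetP/(all_nthP (false, false)) => [H i|H i].
  rewrite size_zip sl sm minnn => i_n; rewrite nth_zip ?sl//=.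
  have := H (Ordinal i_n); rewrite !inE /=.
  by case: (nth _ l i) => //= ->.
rewrite !inE => li; have := H i; rewrite size_zip sl sm minnn nth_zip ?sl//=.
by rewrite li /=; apply.
Qed.

End Bits.

Lemma sum_nth_count n l : size l = n ->
  (\sum_(i < n) nth false l i = count id l)%N.
Proof.
move=> <-; rewrite -sumn_count -(big_mkord xpredT (fun i => nth false l i : nat)).
by rewrite sumnE big_map (big_nth false).
Qed.

Lemma sum_inversions n l m : size l = n -> size m = n ->
  (\sum_(i < n) \sum_(j < n) [&& nth false l i, nth false m j & j < i] =
   inversions l m)%N.
Proof.
elim: n l m => [|n IH] [|x l] [|y m] //=; first by rewrite big_ord0.
case=> sl [sm]; rewrite big_ord_recl /= big1 ?add0n; last first.
  by move=> j _; rewrite ltn0 !andbF.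
under eq_bigr do rewrite big_ord_recl /=.
rewrite big_split /= IH//; congr addn.
rewrite -(sum_nth_count sl) big_distrr /=; apply: eq_bigr => i _.
by rewrite andbT; case: y; case: (nth _ l i).
Qed.

Lemma wsign_bits (R : realType) n l m : size l = n -> size m = n ->
  wsign R (bits n l) (bits n m) = (-1) ^+ inversions l m.
Proof.
move=> sl sm; rewrite /wsign -(sum_inversions sl sm); congr (_ ^+ _).
rewrite pair_big /= -sum1_card big_mkcond; apply: eq_bigr => -[i j] _.
by rewrite !inE /= -andbA; case: ifP.
Qed.

(* A list of signed monomials stands for their sum. *)
Definition term := (bool * seq bool)%type.

Definition fneg (q : seq term) : seq term := [seq (~~ t.1, t.2) | t <- q].
(** Signs are booleans, [true] for minus, and multiply by [(+)]; the parity of [inversions] is the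
    reordering sign. Monomials with a common index have product zero, the empty list. *)
Definition mulT (t u : term) : seq term :=
  if bdisj t.2 u.2
  then [:: (t.1 (+) u.1 (+) odd (inversions t.2 u.2), bor t.2 u.2)] else [::].
Definition fwedge (q q' : seq term) : seq term :=
  flatten [seq flatten [seq mulT t u | u <- q'] | t <- q].
Definition hodgeT (t : term) : term :=
  (t.1 (+) odd (inversions t.2 (map negb t.2)), map negb t.2).
Fixpoint coef (q : seq term) (l : seq bool) : int :=
  if q is t :: q' then (if t.2 == l then (-1) ^+ t.1 else 0) + coef q' l else 0.

Definition wf n (q : seq term) := all (fun t => size t.2 == n) q.

Section Eval.
Context (R : realType) (n : nat).
Implicit Types (t u : term) (q : seq term).

Definition evT t : ext R n := (-1) ^+ t.1 *: mono R (bits n t.2).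
Definition ev q : ext R n := \sum_(t <- q) evT t.

Lemma ev_cons t q : ev (t :: q) = evT t + ev q.
Proof. exact: big_cons. Qed.

Lemma ev_cat q q' : ev (q ++ q') = ev q + ev q'.
Proof. by rewrite /ev big_cat. Qed.

Lemma ev_neg q : ev (fneg q) = - ev q.
Proof.
rewrite /ev big_map -sumrN; apply: eq_bigr => -[[] S] _;
by rewrite /evT /= ?expr0 ?expr1 ?scaleN1r ?scale1r ?opprK.
Qed.

Lemma ev_mulT t u : size t.2 = n -> size u.2 = n ->
  ev (mulT t u) = wedge (evT t) (evT u).
Proof.
move=> st su; rewrite wedgeZl wedgeZr wedge_mono bits_disjoint// /mulT.
case: bdisj; last by rewrite /ev big_nil !scaler0.
rewrite /ev big_seq1 /evT /= bits_setU// wsign_bits// !scalerA.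
by rewrite !signr_addb signr_odd.
Qed.

Lemma ev_flatten (qs : seq (seq term)) :
  ev (flatten qs) = \sum_(q <- qs) ev q.
Proof.
elim: qs => [|q qs IH]; first by rewrite /ev !big_nil.
by rewrite /= ev_cat IH big_cons.
Qed.

Lemma ev_wedge q q' : wf n q -> wf n q' ->
  ev (fwedge q q') = wedge (ev q) (ev q').
Proof.
move=> /allP wq /allP wq'; rewrite ev_flatten big_map wedge_suml.
apply: eq_big_seq => t /wq/eqP st; rewrite ev_flatten big_map wedge_sumr.
by apply: eq_big_seq => u /wq'/eqP su; rewrite ev_mulT.
Qed.

Lemma wf_wedge q q' : wf n q -> wf n q' -> wf n (fwedge q q').
Proof.
move=> /allP wq /allP wq'; apply/allP => t /flatten_mapP[u /wq/eqP su].
move=> /flatten_mapP[v /wq'/eqP sv]; rewrite /mulT.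
by case: ifP => // _; rewrite inE => /eqP -> /=; rewrite (@size_bor n).
Qed.

Lemma ev_hodge t : size t.2 = n -> evT (hodgeT t) = hodge (evT t).
Proof.
move=> st; rewrite hodgeZ hodge_mono bits_setC// wsign_bits ?size_map//.
by rewrite /evT /= signr_addb signr_odd scalerA.
Qed.

(** The bridge from real forms to computation: coefficients are found in [int], where they reduce to
    numerals, and only then cast to [R]. *)
Lemma ev_coef q l : wf n q -> size l = n -> ev q (bits n l) = (coef q l)%:~R.
Proof.
move=> wq sl; elim: q wq => [|t q IH] /=; first by rewrite /ev big_nil ffunE.
case/andP => /eqP st /IH {}IH; rewrite /ev big_cons ffunE -/(ev q) IH intrD.
rewrite /evT !ffunE /GRing.scale /= eq_sym bits_inj//.
case: eqP => _; rewrite ?mulr1 ?mulr0//.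
by case: t.1; rewrite ?expr1 ?expr0 ?rmorphN1.
Qed.

End Eval.

(** * The instanton equations as linear systems *)

(* Twice the left side of [* e^m + (W / 2) /\ e^m = 0]. *)
Definition inst_terms (W : seq term) (m : seq bool) : seq term :=
  [:: hodgeT (false, m), hodgeT (false, m) & fwedge W [:: (false, m)]].

Fixpoint bitstrings (n : nat) : seq (seq bool) :=
  if n is k.+1 then
    [seq false :: l | l <- bitstrings k] ++ [seq true :: l | l <- bitstrings k]
  else [:: [::]].

(** The matrix of the equation: rows are indexed by output monomials [l], columns by the unknown
    coefficients on [ms]. Zero rows are dropped to keep the system short. *)
Definition inst_rows n (W : seq term) (ms : seq (seq bool)) : seq (seq int) :=
  [seq c <- [seq [seq coef (inst_terms W m) l | m <- ms] | l <- bitstrings n]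
     | has (predC1 0) c].

(* Zero coefficients are skipped so that the sums reduce to readable ones. *)
Fixpoint comb (R : realType) (x : seq R) (c : seq int) : R :=
  match x, c with
  | y :: x', k :: c' =>
      match k with
      | Posz 0 => comb x' c'
      | Posz j => y *+ j + comb x' c'
      | Negz j => y *- j.+1 + comb x' c'
      end
  | _, _ => 0
  end.

Fixpoint comb_all0 (R : realType) (x : seq R) (cs : seq (seq int)) : Prop :=
  if cs is c :: cs' then comb x c = 0 /\ comb_all0 x cs' else True.

Lemma mem_bitstrings n l : size l = n -> l \in bitstrings n.
Proof.
elim: n l => [|n IH] [|b l] //= [] /IH hl; rewrite mem_cat.
by case: b; rewrite (mem_map (can_inj (g := behead) _)) ?hl ?orbT.
Qed.

Lemma size_bitstrings n l : l \in bitstrings n -> size l = n.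
Proof.
elim: n l => [|n IH] l /=; first by rewrite inE => /eqP ->.
by rewrite mem_cat => /orP[] /mapP[l' /IH <- ->].
Qed.

Lemma comb_all0P (R : realType) (x : seq R) cs :
  comb_all0 x cs <-> {in cs, forall c, comb x c = 0}.
Proof.
elim: cs => [|c cs [IH1 IH2]] /=; first by split.
split=> [[c0 /IH1 h] d|h]; first by rewrite inE => /predU1P[->|/h].
split; first by apply: h; rewrite inE eqxx.
by apply: IH2 => d dcs; apply: h; rewrite inE dcs orbT.
Qed.

Lemma comb_map (R : realType) (x : seq R) (T : Type) (f : T -> int) ms :
  comb x (map f ms) = \sum_(p <- zip x ms) p.1 * (f p.2)%:~R.
Proof.
elim: x ms => [|y x IH] [|m ms] /=; rewrite ?big_nil// big_cons -IH /=.
case: (f m) => [[|k]|k] //; first by rewrite mulr0 add0r.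
- by rewrite mulr_natr.
- by rewrite NegzE mulrNz -pmulrn mulrN mulr_natr.
Qed.

Lemma comb_all_zero (R : realType) (x : seq R) c :
  ~~ has (predC1 0) c -> comb x c = 0.
Proof.
elim: c x => [|k c IH] [|y x] //= /norP[/negPn/eqP -> /IH]; exact.
Qed.

(** Doubling clears the factor 1/2, so the system has integer coefficients. [G] is twice the
    difference of the two sides; its value on each monomial is one row applied to [x]. Every subset
    is a bit string, and the dropped rows hold identically. *)
Lemma inst_eqP (R : realType) n W (x : seq R) ms (F : ext R n) :
  wf n W -> all (fun m => size m == n) ms ->
  F = \sum_(p <- zip x ms) p.1 *: mono R (bits n p.2) ->
  hodge F = - wedge ((2^-1 : R) *: ev R n W) F <->
  comb_all0 x (inst_rows n W ms).
Proof.
move=> wW /allP sm ->; set F' := \sum_(p <- _) _.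
pose G : ext R n := \sum_(p <- zip x ms) p.1 *: ev R n (inst_terms W p.2).
have mem_zip (p : R * seq bool) : p \in zip x ms -> size p.2 = n.
  move=> /(map_f snd) p2; apply/eqP/sm; move: p2; rewrite -/(unzip2 _).
  elim: (x) (ms) => [|y x' IH] [|m ms'] //=; rewrite !inE.
  by case/orP => [->//|/IH ->]; rewrite orbT.
have GE : G = (2 : R) *: (hodge F' + wedge ((2^-1 : R) *: ev R n W) F').
  rewrite scalerDr wedgeZl scalerA mulfV ?pnatr_eq0// scale1r.
  rewrite hodge_sum wedge_sumr scaler_sumr -big_split /=.
  apply: eq_big_seq => p /mem_zip sp.
  rewrite hodgeZ wedgeZr /inst_terms !ev_cons ev_hodge//=.
  have E : evT R n (false, p.2) = mono R (bits n p.2).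
    by rewrite /evT expr0 scale1r.
  rewrite ev_wedge//=; last by rewrite sp eqxx.
  rewrite ev_cons [ev _ _ [::]]big_nil addr0 E addrA !scalerDr !scalerA; congr (_ + _).
  by rewrite -scalerDl; congr (_ *: _); ring.
have wQ (p : R * seq bool) : p \in zip x ms -> wf n (inst_terms W p.2).
  by move=> /mem_zip sp; rewrite /= !size_map sp eqxx wf_wedge//= sp eqxx.
have Gl l : size l = n ->
    G (bits n l) = comb x [seq coef (inst_terms W m) l | m <- ms].
  move=> sl; rewrite comb_map /G sum_ffunE; apply: eq_big_seq => p /wQ wp.
  by rewrite ffunE ev_coef.
have -> : hodge F' = - wedge ((2^-1 : R) *: ev R n W) F' <-> G = 0.
  rewrite GE; split=> [->|/eqP]; first by rewrite addNr scaler0.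
  by rewrite scaler_eq0 pnatr_eq0 /= addr_eq0 => /eqP.
rewrite comb_all0P; split=> [G0 c|H].
  rewrite mem_filter => /andP[_ /mapP[l /size_bitstrings sl ->]].
  by rewrite -Gl// G0 ffunE.
apply/ffunP => S; have [l sl ->] := bits_ex S; rewrite ffunE Gl//.
case: (boolP (has (predC1 0) [seq coef (inst_terms W m) l | m <- ms])) => h.
  by apply: H; rewrite mem_filter h; apply: map_f; exact: mem_bitstrings.
exact: comb_all_zero.
Qed.

(** * The Kähler forms and the forms [Phi] as signed monomials *)

Definition bits2 (i j : nat) : seq bool :=
  mkseq (fun k => (k == i) || (k == j)) 8.

Definition omega_terms (L : hkindex) : seq term :=
  match L with
  | LI => [:: (true, bits2 0 7); (false, bits2 5 6); (false, bits2 1 2);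
              (true, bits2 3 4)]
  | LJ => [:: (true, bits2 0 6); (true, bits2 5 7); (true, bits2 2 3);
              (false, bits2 1 4)]
  | LK => [:: (false, bits2 0 5); (true, bits2 6 7); (false, bits2 2 4);
              (false, bits2 1 3)]
  end.

Definition sq_terms (L : hkindex) := fwedge (omega_terms L) (omega_terms L).

(** These represent [2 Phi], so that the coefficients stay integral; [PhiE] restores the factor
    1/2. *)
Definition Phi_terms (L : hkindex) : seq term :=
  match L with
  | LI => sq_terms LI ++ sq_terms LJ ++ fneg (sq_terms LK)
  | LJ => fneg (sq_terms LI) ++ sq_terms LJ ++ sq_terms LK
  | LK => sq_terms LI ++ fneg (sq_terms LJ) ++ sq_terms LK
  end.

Section Calibrations.
Context (R : realType).

Lemma e2E (i j : 'I_8) : (i < j)%N -> e2 R i j = mono R (bits 8 (bits2 i j)).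
Proof.
move=> ij; rewrite /e2 !covecE wedge_mono.
have b1 k : finset.set1 k = bits 8 (mkseq (pred1 (k : nat)) 8) :> {set 'I_8}.
  by apply/finset.setP => x; rewrite !inE nth_mkseq.
rewrite !b1 bits_disjoint ?size_mkseq// wsign_bits ?size_mkseq//.
rewrite bits_setU ?size_mkseq//.
case: i j ij {b1} => [i hi] [j hj] /=.
by case: i hi => [|[|[|[|[|[|[|[|//]]]]]]]] hi;
  case: j hj => [|[|[|[|[|[|[|[|//]]]]]]]] hj //= _;
  rewrite /bdisj /inversions /= ?expr0 ?scale1r.
Qed.

Lemma omegaE L : omega R L = ev R 8 (omega_terms L).
Proof.
by case: L; rewrite /omega !e2E// !ev_cons [ev _ _ [::]]big_nil /evT /= ?addr0
  ?expr0 ?expr1 ?scale1r ?scaleN1r ?addrA.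
Qed.

Lemma omega_sqE L : omega_sq R L = ev R 8 (sq_terms L).
Proof. by rewrite /omega_sq omegaE -ev_wedge//; case: L. Qed.

Lemma PhiE L : Phi R L = (2^-1 : R) *: ev R 8 (Phi_terms L).
Proof.
rewrite /Phi /Phi_terms !omega_sqE.
move: (sq_terms LI) (sq_terms LJ) (sq_terms LK) => qI qJ qK.
by case: L; rewrite !ev_cat ?ev_neg ?addrA.
Qed.

End Calibrations.

(** In order, the four monomials of each of [omega_I], [omega_J] and [omega_K]. *)
Definition hk_pairs : seq ('I_8 * 'I_8) :=
  [:: (0, 7); (5, 6); (1, 2); (3, 4); (0, 6); (5, 7); (2, 3); (1, 4);
      (0, 5); (6, 7); (2, 4); (1, 3)].

Definition hk_bits : seq (seq bool) := [seq bits2 p.1 p.2 | p : 'I_8 * 'I_8 <- hk_pairs].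

Section HkForms.
Context (R : realType) (F : 'I_8 -> 'I_8 -> R).

Definition hk_form : ext R 8 := \sum_(p <- hk_pairs) F p.1 p.2 *: e2 R p.1 p.2.

Let x : seq R := [seq F p.1 p.2 | p <- hk_pairs].

Let hk_formE : hk_form = \sum_(p <- zip x hk_bits) p.1 *: mono R (bits 8 p.2).
Proof.
rewrite zip_map big_map; apply: eq_big_seq => p pP; rewrite e2E//.
by move: p pP; apply/allP; vm_compute.
Qed.

(** The solutions are the primitive forms of type (1,1) for [L]: the first condition is primitivity,
    and the four equalities remove the (2,0) and (0,2) parts, two in each of the other blocks. *)
Lemma su4_hk_form L :
  hodge hk_form = - wedge ((2^-1 : R) *: omega_sq R L) hk_form <->
  match L with
  | LI => [/\ F 0 7 - F 5 6 - F 1 2 + F 3 4 = 0, F 0 6 = - F 5 7,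
             F 2 3 = F 1 4, F 0 5 = F 6 7 & F 2 4 = - F 1 3]
  | LJ => [/\ F 0 6 + F 5 7 + F 2 3 - F 1 4 = 0, F 0 7 = F 5 6,
             F 1 2 = F 3 4, F 0 5 = F 6 7 & F 2 4 = - F 1 3]
  | LK => [/\ F 0 5 - F 6 7 + F 2 4 + F 1 3 = 0, F 0 7 = F 5 6,
             F 1 2 = F 3 4, F 0 6 = - F 5 7 & F 2 3 = F 1 4]
  end.
Proof.
rewrite omega_sqE (inst_eqP (ms := hk_bits) _ _ hk_formE);
  [|by case: L|by vm_compute].
(* Twelve nonzero rows remain; as linear systems they are equivalent to the five stated
   conditions. *)
by case: L; set rows := inst_rows _ _ _; vm_compute in rows; rewrite /x /rows /=;
  (split; [do 12!case=> ?; move=> _; split; lra | case=> *; do !split; lra]).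
Qed.

(* SU(4) is contained in Spin(7). *)
Lemma spin7_hk_form L :
  hodge hk_form = - wedge ((2^-1 : R) *: omega_sq R L) hk_form ->
  hodge hk_form = - wedge (Phi R L) hk_form.
Proof.
move/su4_hk_form => su4; rewrite PhiE.
apply/(inst_eqP (ms := hk_bits) _ _ hk_formE);
  [by case: L {su4}|by vm_compute|].
by case: L su4; set rows := inst_rows _ _ _; vm_compute in rows;
  rewrite /x /rows /=; case=> *; do !split; lra.
Qed.

End HkForms.

(** * Curvature of an invariant connection *)

Section MaurerCartan.
Context (R : realType).
Implicit Types (X Y : 'M[R[i]]_3).

Lemma su3_mcmx (z k : R) (nu sg mu : R[i]) : su3 (mcmx z k nu sg mu).
Proof.
split.
  case: nu sg mu => [? ?] [? ?] [? ?]; apply/matrixP => i j; rewrite !mxE.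
  by case: i => [[|[|[|//]]]] hi; case: j => [[|[|[|//]]]] hj; apply/eqP;
    rewrite eq_complex /=; apply/andP; split; apply/eqP; ring.
rewrite /mxtrace !big_ord_recl big_ord0 !mxE /=; apply/eqP.
by rewrite eq_complex /=; apply/andP; split; apply/eqP; ring.
Qed.

Lemma su30 : su3 (0 : 'M[R[i]]_3).
Proof. by split; rewrite ?linear0 ?map_mx0 ?trmx0 ?oppr0 ?mxtrace0. Qed.

Lemma su3_commutator X Y : su3 X -> su3 Y -> su3 (X *m Y - Y *m X).
Proof.
move=> [hX _] [hY _]; split; last by rewrite raddfB /= mxtrace_mulC subrr.
rewrite linearB /= map_mxB !trmx_mul !map_mxM /= hX hY.
by rewrite !mulNmx !mulmxN !opprK opprB.
Qed.

Lemma mulmx3E X Y i j : (X *m Y) i j = X i 0 * Y 0 j + X i 1 * Y 1 j + X i 2 * Y 2 j.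
Proof.
rewrite !mxE !big_ord_recl big_ord0 addr0 addrA.
by congr (_ + X i _ * Y _ j + X i _ * Y _ j); apply: val_inj.
Qed.

(** The Maurer-Cartan equations: a left-invariant form satisfies [d alpha (X, Y) = - alpha [X, Y]],
    so the right sides are minus the differentials of [zeta], [kappa], [nu_1], [nu_2]. They do not
    contain [zeta X] or [zeta Y], because K_0 centralizes the upper left block. *)
Lemma commutator_coords X Y : su3 X -> su3 Y ->
  let Z := X *m Y - Y *m X in
  [/\ zeta Z = sigma1 X * sigma2 Y - sigma2 X * sigma1 Y
               + (mu1 X * mu2 Y - mu2 X * mu1 Y),
      kappa Z = 2 * (nu1 X * nu2 Y - nu2 X * nu1 Y)
                + (sigma1 X * sigma2 Y - sigma2 X * sigma1 Y)
                - (mu1 X * mu2 Y - mu2 X * mu1 Y),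
      nu1 Z = - (2 * (kappa X * nu2 Y - nu2 X * kappa Y)
                 + (sigma1 X * mu1 Y - mu1 X * sigma1 Y)
                 + (sigma2 X * mu2 Y - mu2 X * sigma2 Y))
    & nu2 Z = 2 * (kappa X * nu1 Y - nu1 X * kappa Y)
              - (sigma2 X * mu1 Y - mu1 X * sigma2 Y)
              + (sigma1 X * mu2 Y - mu2 X * sigma1 Y)].
Proof.
move=> /mcmx_coords <- /mcmx_coords <- Z.
move: (zeta X) (kappa X) (nu1 X) (nu2 X) (sigma1 X) (sigma2 X) (mu1 X) (mu2 X)
      (zeta Y) (kappa Y) (nu1 Y) (nu2 Y) (sigma1 Y) (sigma2 Y) (mu1 Y) (mu2 Y)
  => x0 x1 x2 x3 x4 x5 x6 x7 y0 y1 y2 y3 y4 y5 y6 y7 in Z *.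
have ZE i j : Z i j =
    let X := mcmx x0 x1 (x2 +i* x3)%C (x4 +i* x5)%C (x6 +i* x7)%C in
    let Y := mcmx y0 y1 (y2 +i* y3)%C (y4 +i* y5)%C (y6 +i* y7)%C in
    X i 0 * Y 0 j + X i 1 * Y 1 j + X i 2 * Y 2 j
    - (Y i 0 * X 0 j + Y i 1 * X 1 j + Y i 2 * X 2 j).
  by rewrite /= -!mulmx3E [LHS]mxE [X in _ + X]mxE.
rewrite /(zeta Z) /(kappa Z) /(nu1 Z) /(nu2 Z) !{}ZE {Z}.
rewrite /zeta /kappa /nu1 /nu2 /sigma1 /sigma2 /mu1 /mu2 !mxE /=.
by split; field.
Qed.

End MaurerCartan.

Section Curvature.
Context (R : realType) (n : int) (A : form1E R) (p0 p1 p2 : R -> R).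
Context (hA : has_coeffs n A p0 p1 p2).
Context (dp0 : forall r, 1 < r -> derivable p0 r 1).
Context (dp1 : forall r, 1 < r -> derivable p1 r 1).
Context (dp2 : forall r, 1 < r -> derivable p2 r 1).
Context (r : R) (h : 'M[R[i]]_3).
Context (r1 : 1 < r) (hh : SU3 h).

Lemma derive1_pullA (v : tvec R) : su3 v.2 ->
  derive1 (fun t => pullA A t h v) r =
  derive1 p0 r * kappa v.2 + derive1 p1 r * nu1 v.2 + derive1 p2 r * nu2 v.2.
Proof.
move=> hv; rewrite !derive1E.
have E : is_derive r 1 (cst (n%:~R * zeta v.2) + (kappa v.2 \*: p0
    + nu1 v.2 \*: p1 + nu2 v.2 \*: p2)) (0 + (kappa v.2 *: 'D_1 p0 r
    + nu1 v.2 *: 'D_1 p1 r + nu2 v.2 *: 'D_1 p2 r)).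
  have e0 := derivableP (dp0 r1); have e1 := derivableP (dp1 r1).
  have e2 := derivableP (dp2 r1).
  exact: is_deriveD.
rewrite -[RHS]add0r; transitivity ('D_1 (cst (n%:~R * zeta v.2) +
    (kappa v.2 \*: p0 + nu1 v.2 \*: p1 + nu2 v.2 \*: p2)) r).
  (* [has_coeffs] speaks only of [t > 1], so the two functions are compared near [r]. *)
  apply: near_eq_derive; near=> t.
  rewrite hA//; last by near: t; exact: lt_nbhsr.
  by rewrite !fctE ![_ * kappa _]mulrC ![_ * nu1 _]mulrC ![_ * nu2 _]mulrC.
by rewrite derive_val ![_ * kappa _]mulrC ![_ * nu1 _]mulrC ![_ * nu2 _]mulrC.
Unshelve. all: by end_near.
Qed.

Lemma curvature_coords (v w : tvec R) : su3 v.2 -> su3 w.2 ->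
  let Z := v.2 *m w.2 - w.2 *m v.2 in
  curvature A r h v w =
  v.1 * (derive1 p0 r * kappa w.2 + derive1 p1 r * nu1 w.2
         + derive1 p2 r * nu2 w.2)
  - w.1 * (derive1 p0 r * kappa v.2 + derive1 p1 r * nu1 v.2
           + derive1 p2 r * nu2 v.2)
  - (n%:~R * zeta Z + (p0 r * kappa Z + p1 r * nu1 Z + p2 r * nu2 Z)).
Proof.
move=> hv hw Z; rewrite /curvature !derive1_pullA// hA//=.
exact: su3_commutator.
Qed.

Lemma su3_frame j : su3 (frame r j).2.
Proof.
by case: j => [[|[|[|[|[|[|[|[|//]]]]]]]] hj]; rewrite /frame /=;
  [exact: su30|..]; exact: su3_mcmx.
Qed.

Lemma frame_coords j :
  [/\ (frame r j).1 = (j == 0%N :> nat)%:R / cal_dt r,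
      sigma1 (frame r j).2 = (j == 1%N :> nat)%:R / cal_a r,
      sigma2 (frame r j).2 = (j == 2%N :> nat)%:R / cal_a r,
      mu1 (frame r j).2 = (j == 3%N :> nat)%:R / cal_b r &
  [/\ mu2 (frame r j).2 = (j == 4%N :> nat)%:R / cal_b r,
      nu1 (frame r j).2 = (j == 5%N :> nat)%:R / cal_c r,
      nu2 (frame r j).2 = (j == 6%N :> nat)%:R / cal_c r &
      kappa (frame r j).2 = (j == 7%N :> nat)%:R / cal_f r]].
Proof.
rewrite /sigma1 /sigma2 /mu1 /mu2 /nu1 /nu2 /kappa.
case: j => [[|[|[|[|[|[|[|[|//]]]]]]]] hj]; rewrite /frame !mxE /=;
  do !split; rewrite ?mul0r ?mul1r ?oppr0 ?subrr ?mul0r//;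
  by [field | move: (cal_f r)^-1 => k; field].
Qed.

Let a := cal_a r.
Let b := cal_b r.
Let c := cal_c r.
Let f := cal_f r.
Let d := cal_dt r.
Let F i j := curvature A r h (frame r i) (frame r j).

(** All components of [dA] in a single identity, with [D] and [E] the Kronecker symbols of [i] and
    [j]. The first three terms are [dp_k] wedged with [kappa], [nu_1], [nu_2]; the others come from
    the Maurer-Cartan equations. *)
Let FE (i j : 'I_8) :
  let D k : R := (i == k :> nat)%:R in let E k : R := (j == k :> nat)%:R in
  F i j =
  (D 0%N * E 7%N - D 7%N * E 0%N) * derive1 p0 r / d / f
  + (D 0%N * E 5%N - D 5%N * E 0%N) * derive1 p1 r / d / c
  + (D 0%N * E 6%N - D 6%N * E 0%N) * derive1 p2 r / d / c
  - (D 1%N * E 2%N - D 2%N * E 1%N) * (n%:~R + p0 r) / a / a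
  - (D 3%N * E 4%N - D 4%N * E 3%N) * (n%:~R - p0 r) / b / b
  - (D 5%N * E 6%N - D 6%N * E 5%N) * 2 * p0 r / c / c
  + (D 7%N * E 6%N - D 6%N * E 7%N) * 2 * p1 r / f / c
  - (D 7%N * E 5%N - D 5%N * E 7%N) * 2 * p2 r / f / c
  + (D 1%N * E 3%N - D 3%N * E 1%N + (D 2%N * E 4%N - D 4%N * E 2%N)) * p1 r / a / b
  + (D 2%N * E 3%N - D 3%N * E 2%N - (D 1%N * E 4%N - D 4%N * E 1%N)) * p2 r / a / b.
Proof.
move=> D E; rewrite /F curvature_coords; [|exact: su3_frame..].
have [-> -> -> ->] := commutator_coords (su3_frame i) (su3_frame j).
have [-> -> -> -> [-> -> -> ->]] := frame_coords i.
have [-> -> -> -> [-> -> -> ->]] := frame_coords j.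
rewrite -/a -/b -/c -/d -/f -/(D _) -/(E _).
by ring.
Qed.

Lemma curvature_frame :
  [/\ [/\ F 0 7 = derive1 p0 r / (d * f), F 5 6 = - 2 * p0 r / c ^+ 2,
          F 1 2 = - (n%:~R + p0 r) / a ^+ 2 & F 3 4 = (p0 r - n%:~R) / b ^+ 2],
      [/\ F 0 6 = derive1 p2 r / (d * c), F 5 7 = 2 * p2 r / (c * f),
          F 2 3 = p2 r / (a * b) & F 1 4 = - p2 r / (a * b)]
    & [/\ F 0 5 = derive1 p1 r / (d * c), F 6 7 = - 2 * p1 r / (c * f),
          F 2 4 = p1 r / (a * b) & F 1 3 = p1 r / (a * b)]].
Proof.
(* A multirule that evaluates ordinals to numerals, so that the Kronecker symbols in [FE]
   compute. *)
have v : (((0 : 'I_8) = 0%N :> nat) * ((1 : 'I_8) = 1%N :> nat) *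
  ((2 : 'I_8) = 2%N :> nat) * ((3 : 'I_8) = 3%N :> nat) *
  ((4 : 'I_8) = 4%N :> nat) * ((5 : 'I_8) = 5%N :> nat) *
  ((6 : 'I_8) = 6%N :> nat) * ((7 : 'I_8) = 7%N :> nat))%type by [].
by do !split; rewrite FE !v /= ?invfM ?expr2; ring.
Qed.

Lemma curvature_form_hk : curvature_form A r h = hk_form F.
Proof.
rewrite /curvature_form /hk_form pair_big_dep /=.
have uP : uniq hk_pairs by vm_compute.
rewrite [RHS]big_uniq//= big_mkcond [RHS]big_mkcond.
apply: eq_bigr => -[i j] _ /=.
have lt p : p \in hk_pairs -> (p.1 < p.2)%N.
  by move: p; apply/allP; vm_compute.
suff F0 : (i < j)%N -> (i, j) \notin hk_pairs -> F i j = 0.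
  case: ifP => ij; case: ifP => //; last by move=> /lt /=; rewrite ij.
  by move=> /negbT/(F0 ij); rewrite /F => ->; rewrite scale0r.
move=> ij nP; pose P := [seq (p.1 : nat, p.2 : nat) | p : 'I_8 * 'I_8 <- hk_pairs].
(* Each product of Kronecker symbols in [FE] has its indices in [hk_pairs], up to order. In the
   listed order it would put [(i, j)] in the list; in the reverse order it contradicts [i < j]. *)
have Z k l : ((k, l) \in P) || ((l, k) \in P) ->
    (i == k :> nat)%:R * (j == l :> nat)%:R = 0 :> R.
  rewrite -natrM mulnb; case: andP => // -[/eqP <- /eqP <-] /orP[] /mapP[p pP].
    by case: p pP nP => i' j' pP nP [/val_inj ei /val_inj ej]; rewrite ei ej pP in nP.
  by case: p pP => i' j' /lt /= lt' [ej ei]; move: ij; rewrite ei ej ltnNge ltnW.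
by rewrite FE !Z// !(subrr, mul0r, addr0).
Qed.

End Curvature.

(** * The shape of an invariant connection in temporal gauge *)

Lemma SU3_1 (R : realType) : SU3 (1%:M : 'M[R[i]]_3).
Proof.
split; last exact: det1.
by apply/unitarymxP; rewrite trmx1 map_mx1 mulmx1.
Qed.

Lemma SU3_K0elt (R : realType) (z : R[i]) : `|z| = 1 -> SU3 (K0elt z).
Proof.
move=> z1; have z0 : z != 0 by rewrite -normr_eq0 z1 oner_neq0.
have zz : z * z^* = 1 by rewrite -normCK z1 expr1n.
split; last first.
  rewrite det_diag !big_ord_recl big_ord0 !mxE /= mulr1.
  by rewrite mulrA -expr2 mulfV// expf_neq0.
apply/unitarymxP/matrixP => i j; rewrite mul_diag_mx !mxE eq_sym.
case: i => [[|[|[|//]]]] hi; case: j => [[|[|[|//]]]] hj;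
  rewrite /= ?conjc0 ?mulr0 // ?mulr0n ?rmorph0 ?mulr0 //= ?mulr1n //.
by rewrite fmorphV rmorphXn /= -invfM -exprMn zz expr1n invr1.
Qed.

Lemma su3_lin (R : realType) (c : R) (X Y : 'M[R[i]]_3) :
  su3 X -> su3 Y -> su3 (c%:C%C *: X + Y).
Proof.
move=> [hX tX] [hY tY]; split; last first.
  by rewrite mxtraceD mxtraceZ tX tY mulr0 addr0.
apply/matrixP => i j.
have := congr1 (fun M : 'M[R[i]]_3 => M i j) hX.
have := congr1 (fun M : 'M[R[i]]_3 => M i j) hY.
rewrite !mxE rmorphD rmorphM /= => -> ->.
by rewrite conj_Creal ?complex_real// mulrN opprD.
Qed.

Lemma K0gen_mcmx (R : realType) : K0gen R = mcmx 1 0 0 0 0.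
Proof.
apply/matrixP => i j; rewrite !mxE.
by case: i => [[|[|[|//]]]] hi; case: j => [[|[|[|//]]]] hj; apply/eqP;
  rewrite eq_complex /=; apply/andP; split; apply/eqP; ring.
Qed.

Lemma su3_K0gen (R : realType) : su3 (K0gen R).
Proof. by rewrite K0gen_mcmx; exact: su3_mcmx. Qed.

(** Left invariance moves the base point to the identity and the gauge removes [dr], so linearity
    leaves the values on a basis of su(3). The K_0 direction is fixed by the bundle, the [sigma] and
    [mu] directions vanish by K_0-invariance, and three free functions remain. *)
Lemma invariant_connection_coeffs (R : realType) (n : int) (A : form1E R) :
  invariant_connection n A -> temporal_gauge A ->
  let p X r := A r 1%:M 1 (0, X, 0) in
  has_coeffs n A (p (mcmx 0 1 0 0 0)) (p (mcmx 0 0 (1 +i* 0)%C 0 0))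
    (p (mcmx 0 0 (0 +i* 1)%C 0 0)).
Proof.
move=> hA hT p r h [x X] r1 hh /= hX.
have S1 := SU3_1 R.
have n1 : `|1 : R[i]| = 1 by exact: normr1.
have lin c Y Z : su3 Y -> su3 Z ->
    p (c%:C%C *: Y + Z) r = c * p Y r + p Z r.
  move=> hY hZ; rewrite /p -(ic_linear hA)//.
  by rewrite mulr0 addr0.
have p_0 : p 0 r = 0.
  have := lin (-1) 0 0 (su30 R) (su30 R).
  by rewrite scaler0 addr0 mulN1r addNr.
have -> : pullA A r h (x, X) = p X r.
  have := ic_linear hA x 1 0 0 0 r1 hh n1 (su30 R) hX.
  rewrite mulr1 addr0 scaler0 mulr0 !add0r /pullA /= => ->; rewrite hT// mulr0 add0r.
  by rewrite -[h]mulmx1 (ic_SU3 hA).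
(* The vector [(0, K0gen R, n)], killed by [A], is [(0, K0gen R, 0)] plus [-n] times [(0, 0, -1)],
   on which [A] is 1. *)
have pK : p (K0gen R) r = n%:~R.
  have := ic_linear hA (- n%:~R) 0 0 (-1) 0 r1 S1 n1 (su30 R) (su3_K0gen R).
  rewrite mulr0 add0r scaler0 add0r mulrNN mulr1 addr0 (ic_basic hA)//.
  by rewrite (ic_vert hA)// mulr1 => /esym/eqP; rewrite addrC subr_eq0 => /eqP.
(* Conjugation by [K0elt (-1)], that is [diag(-1, -1, 1)], negates the [sigma] and [mu] entries;
   invariance then gives [p V = - p V]. *)
have pV sg mu : p (mcmx 0 0 0 sg mu) r = 0.
  case: sg mu => [s s'] [m m']; set V := mcmx _ _ _ _ _.
  have hV : su3 V by exact: su3_mcmx.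
  have m1 : `|-1 : R[i]| = 1 by rewrite normrN1.
  have mn : `|(-1 : R[i]) ^ n| = 1.
    by case: (n) => k; rewrite ?NegzE ?exprN ?normfV normrX normrN1 expr1n ?invr1.
  have KV : invmx (K0elt (-1)) *m V *m K0elt (-1) = (-1)%:C%C *: V + 0.
    rewrite invmx_K0elt// addr0; apply/matrixP => i j.
    rewrite mul_mx_diag mul_diag_mx !mxE invrN1 sqrrN expr1n invr1.
    by case: i => [[|[|[|//]]]] hi; case: j => [[|[|[|//]]]] hj; apply/eqP;
      rewrite eq_complex /=; apply/andP; split; apply/eqP; ring.
  have := ic_K0 hA 0 0 r1 S1 n1 m1 hV.
  have sV : su3 ((-1)%:C%C *: V + 0) by apply: su3_lin => //; exact: su30.
  have SK : SU3 (K0elt (-1 : R[i])) by exact: SU3_K0elt.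
  rewrite mul1mx mul1r KV -[X in A r X]mulmx1 (ic_SU3 hA)//; last first.
  (* The fibre coordinate is put in the form [s'^-1 * 1], so that invariance under the structure
     group returns it to 1. *)
  have -> : (-1) ^ n = ((-1) ^ n)^-1^-1 * 1 :> R[i] by rewrite invrK mulr1.
  rewrite (ic_S1 hA)//; last first.
  - by rewrite normfV mn invr1.
  rewrite -/(p _ r) -/(p V r) lin//; last exact: su30.
  by rewrite p_0; lra.
rewrite -{1}(mcmx_coords hX).
have -> : mcmx (zeta X) (kappa X) (nu1 X +i* nu2 X)%C (sigma1 X +i* sigma2 X)%C
    (mu1 X +i* mu2 X)%C =
  (zeta X)%:C%C *: K0gen R + ((kappa X)%:C%C *: mcmx 0 1 0 0 0 +
  ((nu1 X)%:C%C *: mcmx 0 0 (1 +i* 0)%C 0 0 +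
  ((nu2 X)%:C%C *: mcmx 0 0 (0 +i* 1)%C 0 0 +
   mcmx 0 0 0 (sigma1 X +i* sigma2 X)%C (mu1 X +i* mu2 X)%C))).
  rewrite K0gen_mcmx; apply/matrixP => i j; rewrite !mxE.
  by case: i => [[|[|[|//]]]] hi; case: j => [[|[|[|//]]]] hj; apply/eqP;
  rewrite eq_complex /=; apply/andP; split; apply/eqP; ring.
rewrite !lin ?pK ?pV ?addr0; do ?[exact: su3_lin | exact: su3_mcmx
  | exact: su3_K0gen | apply: su3_lin].
by ring.
Qed.

(** * The ordinary differential equations *)

Lemma is_derive0_gt1_cst (R : realType) (u : R -> R) :
  (forall r : R, 1 < r -> is_derive r (1 : R) u 0) ->
  forall r s : R, 1 < r -> 1 < s -> u r = u s.
Proof.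
move=> du r s r1 s1.
wlog rs : r s r1 s1 / r <= s by move=> H; case: (leP r s) => [/H->//|/ltW/H->].
have [x||x _] := @MVT_segment R u (fun=> 0) r s rs.
- by rewrite in_itv /= => /andP[rx _]; apply: du; exact: lt_trans rx.
- apply: derivable_within_continuous => x; rewrite in_itv /= => /andP[rx _].
  by have /du[] := lt_le_trans r1 rx.
by rewrite mul0r => /eqP; rewrite subr_eq0 => /eqP.
Qed.

(* With the integrating factor [w], a linear first order equation becomes
   [(p w)' = g']. *)
Lemma linear_ode_gt1 (R : realType) (p w g w' g' : R -> R) :
  (forall r : R, 1 < r -> derivable p r 1) ->
  (forall r : R, 1 < r -> is_derive r (1 : R) w (w' r)) ->
  (forall r : R, 1 < r -> is_derive r (1 : R) g (g' r)) ->
  (forall r : R, 1 < r -> derive1 p r * w r + p r * w' r = g' r) <->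
  exists C, forall r : R, 1 < r -> p r * w r = g r + C.
Proof.
move=> dp dw dg; pose u : R -> R := p * w - g.
have du (r : R) : 1 < r ->
    is_derive r (1 : R) u (derive1 p r * w r + p r * w' r - g' r).
  move=> r1; have e := derivableP (dp _ r1); have ew := dw _ r1.
  have eg := dg _ r1; apply: is_derive_eq.
  by rewrite derive1E [_ * w r]mulrC; congr (_ - _); exact: addrC.
split=> [H|[C H] r r1].
  (* [u = p w - g] has zero derivative, hence is constant; 2 is an arbitrary base point in (1,
     oo). *)
  exists (u 2) => r r1; have <- : u r = u 2.
    apply: is_derive0_gt1_cst; rewrite ?ltr1n// => t t1.
    by have := du t t1; rewrite H// subrr.
  by rewrite /u !fctE [RHS]addrC subrK.
have : is_derive r (1 : R) u 0.
  have ec : is_derive r (1 : R) (cst C) (0 : R) by exact: is_derive_cst.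
  apply: near_eq_is_derive ec.
  near=> t; rewrite /u !fctE H; last by near: t; exact: lt_nbhsr.
  by rewrite addrC addKr.
move=> [_ E]; have [_] := du r r1; rewrite E => /esym/eqP.
by rewrite subr_eq0 => /eqP.
Unshelve. all: by end_near.
Qed.

Lemma derive1_eq0_gt1 (R : realType) (p : R -> R) :
  (forall r : R, 1 < r -> p r = 0) -> forall r : R, 1 < r -> derive1 p r = 0.
Proof.
move=> p0 r r1; rewrite derive1E -[RHS](derive_cst (0 : R) r 1).
apply: near_eq_derive; near=> t; apply: p0; near: t; exact: lt_nbhsr.
Unshelve. all: by end_near.
Qed.

(** The metric functions enter the curvature only through squares and pairwise products, which are
    rational in [r] and [s]. This reduces the instanton equations to field identities. *)
Lemma cal_metric (R : realType) (r : R) : 1 < r ->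
  let s := Num.sqrt (r ^+ 4 - 1) in
  [/\ 0 < s, s ^+ 2 = r ^+ 4 - 1, cal_a r ^+ 2 = (r ^+ 2 - 1) / 2,
      cal_b r ^+ 2 = (r ^+ 2 + 1) / 2
   & [/\ cal_a r * cal_b r = s / 2, cal_dt r * cal_f r = r,
      cal_dt r * cal_c r = r ^+ 3 / s & cal_c r * cal_f r = s]].
Proof.
move=> r1 s; have r0 : 0 < r by apply: lt_trans r1.
have rn : r != 0 by rewrite gt_eqF.
have r2 : 0 < r ^+ 2 - 1 by rewrite subr_gt0 exprn_egt1.
have r4 : 0 < r ^+ 4 - 1 by rewrite subr_gt0 exprn_egt1.
have s0 : 0 < s by rewrite sqrtr_gt0.
have sn : s != 0 by rewrite gt_eqF.
have r2' : 0 <= (r ^+ 2 - 1) / 2 by rewrite divr_ge0// ltW.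
have r2'' : 0 <= (r ^+ 2 + 1) / 2 by rewrite divr_ge0// addr_ge0// exprn_ge0// ltW.
have dE : cal_dt r = r ^+ 2 / s.
  rewrite /cal_dt sqrtrM ?exprn_ge0 ?ltW// sqrtrV ?ltW//.
  by rewrite (_ : r ^+ 4 = (r ^+ 2) ^+ 2) ?sqrtr_sqr ?ger0_norm ?exprn_ge0 ?ltW// -exprM.
split=> //; [exact/sqr_sqrtr/ltW | exact: sqr_sqrtr | exact: sqr_sqrtr | ].
rewrite dE /cal_f /cal_c -/s; split.
- rewrite /cal_a /cal_b -sqrtrM//.
  have -> : (r ^+ 2 - 1) / 2 * ((r ^+ 2 + 1) / 2) = (r ^+ 4 - 1) * 2^-1 ^+ 2.
    by field.
  by rewrite sqrtrM ?ltW// sqrtr_sqr ger0_norm// invr_ge0.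
- by field; rewrite rn sn.
- by field.
- by rewrite mulrA mulfV// mul1r.
Qed.

Lemma is_derive_exp (R : realType) (k : nat) (r : R) :
  is_derive r (1 : R) (fun x => x ^+ k) (k%:R * r ^+ k.-1).
Proof.
have E : is_derive r (1 : R) (id : R -> R) 1 by exact: is_derive_id.
case: k => [|k]; first by rewrite mul0r; exact: is_derive_cst.
have Ek := is_deriveX k E.
rewrite (_ : (fun x => _) = id ^+ k.+1 :> (R -> R)); last first.
  by apply/funext => x; rewrite fctE.
apply: is_derive_eq; by rewrite -[_ *: _]/(_ * _) mulr1.
Qed.

(** * The SU(4)-instanton equations in terms of [p0], [p1], [p2] *)

Section ReducedEquations.
Context (R : realType) (n : int) (A : form1E R) (p0 p1 p2 : R -> R).
Context (hp : has_coeffs n A p0 p1 p2).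
Context (dp0 : forall r : R, 1 < r -> derivable p0 r 1).
Context (dp1 : forall r : R, 1 < r -> derivable p1 r 1).
Context (dp2 : forall r : R, 1 < r -> derivable p2 r 1).

(** The curvature components are inserted in [su4_hk_form]. [EI] and [EW] treat the primitivity
    condition, in the block of [p0] and in those of [p1], [p2]; [E0], [E1] and [EZ] treat the paired
    conditions in the remaining blocks. *)
Lemma su4_components L (r : R) h : 1 < r -> SU3 h ->
  hodge (curvature_form A r h) =
    - wedge ((2^-1 : R) *: omega_sq R L) (curvature_form A r h) <->
  match L with
  | LI => [/\ derive1 p0 r * (r ^+ 6 - r ^+ 2) + p0 r * (6 * r ^+ 5 - 2 * r)
              = - (4 * n%:~R * r ^+ 3),
             p2 r = 0, derive1 p2 r = 0, p1 r = 0 & derive1 p1 r = 0]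
  | LJ => [/\ derive1 p2 r * (r ^+ 4 - 1) + 6 * r ^+ 3 * p2 r = 0,
             derive1 p0 r * r + 2 * p0 r = 0, p0 r = - (n%:~R / r ^+ 2),
             p1 r = 0 & derive1 p1 r = 0]
  | LK => [/\ derive1 p1 r * (r ^+ 4 - 1) + 6 * r ^+ 3 * p1 r = 0,
             derive1 p0 r * r + 2 * p0 r = 0, p0 r = - (n%:~R / r ^+ 2),
             p2 r = 0 & derive1 p2 r = 0]
  end.
Proof.
move=> r1 hh; rewrite (curvature_form_hk hp dp0 dp1 dp2 r1 hh) su4_hk_form /=.
have [[-> -> -> ->] [-> -> -> ->] [-> -> -> ->]] :=
  curvature_frame hp dp0 dp1 dp2 r1 hh.
have [] := cal_metric r1; set s := Num.sqrt _ => s0 ss -> -> [-> -> -> ->].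
have sn : s != 0 by rewrite gt_eqF.
have rn : r != 0 by rewrite gt_eqF// (lt_trans _ r1).
have r2n : r ^+ 2 - 1 != 0 by rewrite gt_eqF// subr_gt0 exprn_egt1.
have r2n' : r ^+ 2 + 1 != 0.
  by rewrite gt_eqF// addr_gt0// exprn_gt0// (lt_trans _ r1).
have r4n : r ^+ 4 - 1 != 0 by rewrite gt_eqF// subr_gt0 exprn_egt1.
rewrite /cal_c; move: (derive1 p0 r) (derive1 p1 r) (derive1 p2 r) => q0 q1 q2.
move: (p0 r) (p1 r) (p2 r) => y0 y1 y2; move: (n%:~R : R) => m.
(* Each equivalence below holds because the two equations are proportional; the supplied [z] is the
   factor clearing denominators. *)
have eqE (x x' y y' z : R) : z != 0 -> x - x' = (y - y') / z ->
    (x = x') <-> (y = y').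
  move=> zn E; split=> H; apply/eqP; rewrite -subr_eq0.
    by move/eqP: E; rewrite H subrr eq_sym mulf_eq0 invr_eq0 (negPf zn) orbF.
  by rewrite E H subrr mul0r.
have rsn k : r ^+ k * s != 0 by rewrite mulf_neq0// expf_neq0.
have E0 : - (m + y0) / ((r ^+ 2 - 1) / 2) = (y0 - m) / ((r ^+ 2 + 1) / 2) <->
    y0 = - (m / r ^+ 2).
  apply: (eqE _ _ _ _ (- (r ^+ 4 - 1) / (4 * r ^+ 2))).
    by rewrite mulf_neq0// ?oppr_eq0// invr_eq0 mulf_neq0// expf_neq0.
  by field; rewrite rn r2n r2n' r4n.
have E1 : q0 / r = - 2 * y0 / r ^+ 2 <-> q0 * r + 2 * y0 = 0.
  by apply: (eqE _ _ _ _ (r ^+ 2)); [rewrite expf_neq0 | field; rewrite rn].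
(* The second condition equates a multiple of [y] with its negative, so [y = 0]; the first then
   gives [q = 0]. *)
have EZ y q : q / (r ^+ 3 / s) = - (2 * y / s) /\ y / (s / 2) = - (y / (s / 2))
    <-> y = 0 /\ q = 0.
  have [Ey Ey'] : y / (s / 2) = - (y / (s / 2)) <-> y = 0.
    apply: (eqE _ _ _ _ (s / 4)); first by rewrite mulf_neq0.
    by field; rewrite sn.
  have [Eq Eq'] : q / (r ^+ 3 / s) = - (2 * 0 / s) <-> q = 0.
    apply: (eqE _ _ _ _ (r ^+ 3 / s)).
      by rewrite mulf_neq0 ?invr_eq0 ?expf_neq0.
    by field; rewrite rn sn.
  split=> [[Hq /Ey y_0]|[y_0 /Eq' Hq]]; first by split=> //; apply: Eq; rewrite -y_0.
  by split; [rewrite y_0 | exact: Ey'].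
have EW y q : q / (r ^+ 3 / s) + 6 * y / s = 0 <->
    q * (r ^+ 4 - 1) + 6 * r ^+ 3 * y = 0.
  by apply: (eqE _ _ _ _ (r ^+ 3 * s)) => //; rewrite -ss; field; rewrite rn sn.
have EI : q0 / r - -2 * y0 / r ^+ 2 - - (m + y0) / ((r ^+ 2 - 1) / 2)
      + (y0 - m) / ((r ^+ 2 + 1) / 2) = 0 <->
    q0 * (r ^+ 6 - r ^+ 2) + y0 * (6 * r ^+ 5 - 2 * r) = - (4 * m * r ^+ 3).
  apply: (eqE _ _ _ _ (r ^+ 3 * (r ^+ 4 - 1))).
    by rewrite mulf_neq0// expf_neq0.
  by field; rewrite rn r2n r2n' r4n.
have N1 y : - 2 * y / s = - (2 * y / s) by ring.
have N2 y : - y / (s / 2) = - (y / (s / 2)) by ring.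
case: L; rewrite ?N1 ?N2.
- split=> -[a1 a2 a3 a4 a5]; split; move: EI (EZ y1 q1) (EZ y2 q2) a1 a2 a3 a4 a5;
  by clear; tauto.
(* [F 5 7], [F 2 3] and [F 1 4] contribute [2 y2 / s] each; their sum is the source of the exponent
   3/2, as [6 r^3] is 3/2 times the derivative of [r^4 - 1]. *)
- have -> : q2 / (r ^+ 3 / s) + 2 * y2 / s + y2 / (s / 2) - - (y2 / (s / 2)) =
    q2 / (r ^+ 3 / s) + 6 * y2 / s by field; rewrite rn sn.
  split=> -[a1 a2 a3 a4 a5]; split;
  by move: E0 E1 (EZ y1 q1) (EW y2 q2) a1 a2 a3 a4 a5; clear; tauto.
- have -> : q1 / (r ^+ 3 / s) - - (2 * y1 / s) + y1 / (s / 2) + y1 / (s / 2) =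
    q1 / (r ^+ 3 / s) + 6 * y1 / s by field; rewrite rn sn.
  split=> -[a1 a2 a3 a4 a5]; split;
  by move: E0 E1 (EZ y2 q2) (EW y1 q1) a1 a2 a3 a4 a5; clear; tauto.
Qed.

(** The other conditions on derivatives follow once the equations hold at all [r > 1]: a function
    vanishing there has zero derivative, and [p0 = - n / r^2] satisfies [p0' r + 2 p0 = 0]. *)
Lemma su4_reduced L : su4_instanton L A <-> forall r : R, 1 < r ->
  match L with
  | LI => [/\ derive1 p0 r * (r ^+ 6 - r ^+ 2) + p0 r * (6 * r ^+ 5 - 2 * r)
              = - (4 * n%:~R * r ^+ 3), p1 r = 0 & p2 r = 0]
  | LJ => [/\ derive1 p2 r * (r ^+ 4 - 1) + 6 * r ^+ 3 * p2 r = 0,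
              p0 r = - (n%:~R / r ^+ 2) & p1 r = 0]
  | LK => [/\ derive1 p1 r * (r ^+ 4 - 1) + 6 * r ^+ 3 * p1 r = 0,
              p0 r = - (n%:~R / r ^+ 2) & p2 r = 0]
  end.
Proof.
split=> [HA r r1|H r h r1 hh].
  have /su4_components := HA r _ r1 (SU3_1 R).
  by move=> /(_ r1 (SU3_1 R)); case: L {HA} => -[].
apply/su4_components => //.
have q0 : (forall r : R, 1 < r -> p0 r = - (n%:~R / r ^+ 2)) ->
    derive1 p0 r * r + 2 * p0 r = 0.
  move=> p0E; have rn : r != 0 by rewrite gt_eqF// (lt_trans _ r1).
  (* The weight is [r^2]: since [p0 r^2 = - n] is constant, [p0' r^2 + 2 r p0 = 0], and a factor [r]
     is cancelled. *)
  have [_ E] := linear_ode_gt1 dp0 (fun x _ => is_derive_exp 2 x)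
    (fun x _ => is_derive_cst (0 : R) x 1).
  apply: (mulfI rn); rewrite mulr0 -[RHS](E _ r r1).
    by rewrite expr1; ring.
  exists (- n%:~R) => x x1; rewrite add0r p0E// mulNr divfK//.
  by rewrite expf_neq0// gt_eqF// (lt_trans _ x1).
have dz (p : R -> R) : (forall r : R, 1 < r -> p r = 0) -> derive1 p r = 0.
  by move=> p_0; exact: derive1_eq0_gt1.
by case: L H => H; have [h1 h2 h3] := H r r1; split=> //;
  by [apply: q0 => x /H[] | apply: dz => x /H[]].
Qed.

End ReducedEquations.

(** On (1, oo) each coefficient is the value of [A] on one fixed matrix, dual to [kappa], [nu1] or
    [nu2], so [ic_smooth] applies to it. *)
Lemma has_coeffs_derivable (R : realType) (n : int) (A : form1E R)
    (p0 p1 p2 : R -> R) : invariant_connection n A -> has_coeffs n A p0 p1 p2 ->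
  forall r : R, 1 < r ->
  [/\ derivable p0 r 1, derivable p1 r 1 & derivable p2 r 1].
Proof.
move=> hA hp r r1; have n1 : `|1 : R[i]| = 1 by exact: normr1.
have key (p : R -> R) X : su3 X ->
    (forall t : R, 1 < t -> pullA A t 1%:M (0, X) = p t) -> derivable p r 1.
  move=> hX E.
  have sm : smooth_gt1 (fun t => A t 1%:M 1 (0, X, 0)).
    by apply: (ic_smooth hA) => //; exact: SU3_1.
  apply: near_eq_derivable (sm 0%N r r1).
  near=> t; rewrite -E//; near: t; exact: lt_nbhsr.
have ev X t : su3 X -> 1 < t -> pullA A t 1%:M (0, X) = n%:~R * zeta X +
    (p0 t * kappa X + p1 t * nu1 X + p2 t * nu2 X).
  by move=> hX t1; rewrite (hp t _ (0, X) t1 (SU3_1 R) hX).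
split.
- apply: (key _ (mcmx 0 1 0 0 0)) => [|t t1]; first exact: su3_mcmx.
  rewrite ev//; last exact: su3_mcmx.
  by rewrite /zeta /kappa /nu1 /nu2 !mxE /=; field.
- apply: (key _ (mcmx 0 0 (1 +i* 0)%C 0 0)) => [|t t1]; first exact: su3_mcmx.
  rewrite ev//; last exact: su3_mcmx.
  by rewrite /zeta /kappa /nu1 /nu2 !mxE /=; field.
- apply: (key _ (mcmx 0 0 (0 +i* 1)%C 0 0)) => [|t t1]; first exact: su3_mcmx.
  rewrite ev//; last exact: su3_mcmx.
  by rewrite /zeta /kappa /nu1 /nu2 !mxE /=; field.
Unshelve. all: by end_near.
Qed.

Section Solutions.
Context (R : realType).
Implicit Types (p : R -> R) (m : R).

Lemma ode_kappa p m : (forall r : R, 1 < r -> derivable p r 1) ->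
  (forall r : R, 1 < r -> derive1 p r * (r ^+ 6 - r ^+ 2)
     + p r * (6 * r ^+ 5 - 2 * r) = - (4 * m * r ^+ 3)) <->
  exists C, forall r : R, 1 < r ->
    p r = - (1 / r ^+ 2) * (m + C / (r ^+ 4 - 1)).
Proof.
move=> dp.
have dw (r : R) : 1 < r -> is_derive r (1 : R) (fun x : R => x ^+ 6 - x ^+ 2)
    (6 * r ^+ 5 - 2 * r).
  move=> _; have e6 := is_derive_exp 6 r; have e2 := is_derive_exp 2 r.
  exact: (is_deriveB e6 e2).
have dg (r : R) : 1 < r -> is_derive r (1 : R) (fun x : R => - m * x ^+ 4)
    (- (4 * m * r ^+ 3)).
  move=> _; have := is_deriveZ (- m) (is_derive_exp 4 r).
  by rewrite (_ : - (4 * m * r ^+ 3) = - m *: (4 * r ^+ 3))// -[_ *: _]/(_ * _); ring.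
have nz (r : R) : 1 < r -> (r != 0) && (r ^+ 4 - 1 != 0).
  by move=> r1; rewrite gt_eqF ?(lt_trans ltr01)//= gt_eqF// subr_gt0 exprn_egt1.
(* Integration gives [p r^2 (r^4 - 1) = C - m r^4]. Writing [m r^4 = m (r^4 - 1) + m] turns [C] into
   [m - C], an involution, so the same witness serves both directions. *)
rewrite (linear_ode_gt1 dp dw dg); split=> -[C H]; exists (m - C) => r r1.
  have /andP[rn r4n] := nz r r1.
  have wn : r ^+ 6 - r ^+ 2 != 0.
    by rewrite (_ : _ - _ = r ^+ 2 * (r ^+ 4 - 1)) ?mulf_neq0 ?expf_neq0//; ring.
  by apply: (mulIf wn); rewrite H//; field; rewrite rn r4n.
have /andP[rn r4n] := nz r r1.
by rewrite H//; field; rewrite rn r4n.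
Qed.

(** Multiplied by the nonzero [(r^4 - 1)^(1/2)], the equation says that [p (r^4 - 1)^(3/2)] has zero
    derivative. *)
Lemma ode_nu p : (forall r : R, 1 < r -> derivable p r 1) ->
  (forall r : R, 1 < r ->
     derive1 p r * (r ^+ 4 - 1) + 6 * r ^+ 3 * p r = 0) <->
  exists C, forall r : R, 1 < r -> p r = C * (r ^+ 4 - 1) `^ (- (3 / 2)).
Proof.
move=> dp.
have s0 (r : R) : 1 < r -> 0 < r ^+ 4 - 1 by move=> r1; rewrite subr_gt0 exprn_egt1.
have dw (r : R) : 1 < r ->
    is_derive r (1 : R) (fun x : R => (x ^+ 4 - 1) `^ (3 / 2))
      (6 * r ^+ 3 * (r ^+ 4 - 1) `^ (1 / 2)).
  move=> r1.
  have d4 : is_derive r (1 : R) (fun x : R => x ^+ 4 - 1) (4 * r ^+ 3 - 0).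
    by have := is_deriveB (is_derive_exp 4 r) (is_derive_cst (1 : R) r 1).
  have := @is_derive1_comp R (@powR R ^~ (3 / 2)) (fun x => x ^+ 4 - 1) r _ _
    (is_derive1_powR (3 / 2) (s0 r r1)) d4.
  rewrite (_ : 3 / 2 - 1 = 1 / 2 :> R); last by field.
  by rewrite (_ : _ * _ = 6 * r ^+ 3 * (r ^+ 4 - 1) `^ (1 / 2)) //; field.
have wE (r : R) : 1 < r ->
    (r ^+ 4 - 1) `^ (3 / 2) = (r ^+ 4 - 1) * (r ^+ 4 - 1) `^ (1 / 2).
  move=> r1; rewrite (_ : 3 / 2 = 1 + 1 / 2 :> R); last by field.
  rewrite powRD; first by rewrite powRr1// ltW// s0.
  by rewrite gt_eqF ?s0// implybT.
have wn (r : R) : 1 < r -> (r ^+ 4 - 1) `^ (3 / 2) != 0.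
  by move=> r1; rewrite gt_eqF// powR_gt0 ?s0.
have := linear_ode_gt1 dp dw (fun r _ => is_derive_cst (0 : R) r 1).
move=> [HL HR]; split=> [H|[C H] r r1].
  have [r r1|C HC] := HL; last first.
    exists C => r r1; rewrite powRN; apply: (mulIf (wn r r1)).
    by rewrite HC// add0r mulfVK// wn.
  by rewrite wE// -[RHS](mul0r ((r ^+ 4 - 1) `^ (1 / 2))) -(H r r1); ring.
have hn : (r ^+ 4 - 1) `^ (1 / 2) != 0 by rewrite gt_eqF// powR_gt0 ?s0.
apply: (mulIf hn); rewrite mul0r -[RHS](HR _ r r1); first by rewrite wE//; ring.
by exists C => x x1; rewrite H// powRN mulfVK ?add0r// wn.
Qed.

End Solutions.

(** * The three families of SU(4)-instantons *)

Section Instantons.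
Context (R : realType) (n : int) (A : form1E R) (p0 p1 p2 : R -> R).
Context (hp : has_coeffs n A p0 p1 p2).
Context (dp0 : forall r : R, 1 < r -> derivable p0 r 1).
Context (dp1 : forall r : R, 1 < r -> derivable p1 r 1).
Context (dp2 : forall r : R, 1 < r -> derivable p2 r 1).

Lemma su4_spin7 L : su4_instanton L A -> spin7_instanton L A.
Proof.
move=> HA r h r1 hh; have := HA r h r1 hh.
rewrite (curvature_form_hk hp dp0 dp1 dp2 r1 hh); exact: spin7_hk_form.
Qed.

Lemma su4_LI : su4_instanton LI A <-> exists C0, forall r : R, 1 < r ->
  [/\ p0 r = - (1 / r ^+ 2) * (n%:~R + C0 / (r ^+ 4 - 1)), p1 r = 0 & p2 r = 0].
Proof.
have [HL HR] := ode_kappa n%:~R dp0.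
rewrite (su4_reduced hp dp0 dp1 dp2 LI); split=> [H|[C H] r r1].
  have [r /H[]//|C HC] := HL.
  by exists C => r r1; have [_ h1 h2] := H r r1; rewrite h1 h2 HC.
have [_ h1 h2] := H r r1; split=> //; apply: HR => //.
by exists C => x /H[].
Qed.

Lemma su4_LJ : su4_instanton LJ A <-> exists C2, forall r : R, 1 < r ->
  [/\ p0 r = - (n%:~R / r ^+ 2), p1 r = 0
    & p2 r = C2 * (r ^+ 4 - 1) `^ (- (3 / 2))].
Proof.
have [HL HR] := ode_nu dp2.
rewrite (su4_reduced hp dp0 dp1 dp2 LJ); split=> [H|[C H] r r1].
  have [r /H[]//|C HC] := HL.
  by exists C => r r1; have [_ h1 h2] := H r r1; rewrite h1 h2 HC.
have [h1 h2 _] := H r r1; split=> //; apply: HR => //.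
by exists C => x /H[].
Qed.

Lemma su4_LK : su4_instanton LK A <-> exists C1, forall r : R, 1 < r ->
  [/\ p0 r = - (n%:~R / r ^+ 2),
      p1 r = C1 * (r ^+ 4 - 1) `^ (- (3 / 2)) & p2 r = 0].
Proof.
have [HL HR] := ode_nu dp1.
rewrite (su4_reduced hp dp0 dp1 dp2 LK); split=> [H|[C H] r r1].
  have [r /H[]//|C HC] := HL.
  by exists C => r r1; have [_ h1 h2] := H r r1; rewrite h1 h2 HC.
have [h1 _ h2] := H r r1; split=> //; apply: HR => //.
by exists C => x /H[].
Qed.

End Instantons.

Theorem theorem5p5 (R : realType) (n : int) (A : form1E R)
    (hA : invariant_connection n A) (hT : temporal_gauge A) :
  (exists p0 p1 p2 : R -> R, has_coeffs n A p0 p1 p2) /\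
  forall p0 p1 p2 : R -> R, has_coeffs n A p0 p1 p2 ->
  [/\ n <> 0 ->
        (su4_instanton LI A <->
           spin7_instanton LI A /\
           exists C0 C1 C2 : R,
             [/\ spin7_family LI n C0 C1 C2 p0 p1 p2, C1 = 0 & C2 = 0]) /\
        (su4_instanton LI A <->
           exists C0 : R, forall r : R, 1 < r ->
             [/\ p0 r = - (n%:~R / r ^+ 2) * (1 + C0 / (r ^+ 4 - 1)),
                 p1 r = 0 & p2 r = 0]),
      (* the same for every n, with the constant C0 not multiplied by n *)
      (su4_instanton LI A <->
         spin7_instanton LI A /\
         exists C0 C1 C2 : R,
           [/\ spin7_family_I n C0 C1 C2 p0 p1 p2, C1 = 0 & C2 = 0]) /\
      (su4_instanton LI A <->
         exists C0 : R, forall r : R, 1 < r ->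
           [/\ p0 r = - (1 / r ^+ 2) * (n%:~R + C0 / (r ^+ 4 - 1)),
               p1 r = 0 & p2 r = 0]),
      (su4_instanton LJ A <->
         spin7_instanton LJ A /\
         exists C0 C1 C2 : R,
           [/\ spin7_family LJ n C0 C1 C2 p0 p1 p2, C0 = 0 & C1 = 0]) /\
      (su4_instanton LJ A <->
         exists C2 : R, forall r : R, 1 < r ->
           [/\ p0 r = - (n%:~R / r ^+ 2), p1 r = 0
             & p2 r = C2 * (r ^+ 4 - 1) `^ (- (3 / 2))])
    & (su4_instanton LK A <->
         spin7_instanton LK A /\
         exists C0 C1 C2 : R,
           [/\ spin7_family LK n C0 C1 C2 p0 p1 p2, C0 = 0 & C2 = 0]) /\
      (su4_instanton LK A <->
         exists C1 : R, forall r : R, 1 < r ->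
           [/\ p0 r = - (n%:~R / r ^+ 2),
               p1 r = C1 * (r ^+ 4 - 1) `^ (- (3 / 2)) & p2 r = 0])].
Proof.
split.
  by do 3!eexists; exact: invariant_connection_coeffs hT.
move=> p0 p1 p2 hp; have dp := has_coeffs_derivable hA hp.
have dp0 (r : R) : 1 < r -> derivable p0 r 1 by case/dp.
have dp1 (r : R) : 1 < r -> derivable p1 r 1 by case/dp.
have dp2 (r : R) : 1 < r -> derivable p2 r 1 by case/dp.
have S7 := su4_spin7 hp dp0 dp1 dp2.
have SI := su4_LI hp dp0 dp1 dp2.
have SJ := su4_LJ hp dp0 dp1 dp2.
have SK := su4_LK hp dp0 dp1 dp2.
(* The Spin(7) condition is implied by [S7], so each case reduces to matching the explicit solutions
   [Q] with the subfamily [P]. *)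
have with_spin7 L (P Q : Prop) :
    (su4_instanton L A <-> Q) -> (Q <-> P) ->
    (su4_instanton L A <-> spin7_instanton L A /\ P) /\ (su4_instanton L A <-> Q).
  by move: (S7 L); clear; tauto.
split.
- move=> n0; have nz : n%:~R != 0 :> R by rewrite intr_eq0; apply/eqP.
  apply: with_spin7.
    (* [spin7_family] carries the constant [n C0] where [su4_LI] has a free one; passing to [C0]
       divides by [n]. *)
    rewrite SI; split=> -[C H]; [exists (C / n%:~R) | exists (n%:~R * C)];
      move=> r r1; have [-> -> ->] := H r r1; split=> //; last by ring.
    have r4n : r ^+ 4 - 1 != 0 by rewrite gt_eqF// subr_gt0 exprn_egt1.
    by field; rewrite nz r4n gt_eqF ?(lt_trans ltr01).
  split=> [[C H]|[C [C1 [C2 [H e1 e2]]]]].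
    by exists C, 0, 0; split=> // r r1; rewrite !mul0r; exact: H.
  by exists C => r r1; have [-> -> ->] := H r r1; rewrite e1 e2 !mul0r.
- apply: with_spin7 => //; split=> [[C H]|[C [C1 [C2 [H e1 e2]]]]].
    by exists C, 0, 0; split=> // r r1; rewrite !mul0r; exact: H.
  by exists C => r r1; have [-> -> ->] := H r r1; rewrite e1 e2 !mul0r.
- apply: with_spin7 => //; split=> [[C H]|[C0 [C1 [C [H e0 e1]]]]].
    by exists 0, 0, C; split=> // r r1; rewrite !mul0r addr0; exact: H.
  by exists C => r r1; have [-> -> ->] := H r r1; rewrite e0 e1 !mul0r addr0.
- apply: with_spin7 => //; split=> [[C H]|[C0 [C [C2 [H e0 e2]]]]].
    exists 0, C, 0; split=> // r r1; rewrite !mul0r addr0 mulr1; exact: H.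
  by exists C => r r1; have [-> -> ->] := H r r1; rewrite e0 e2 !mul0r addr0 mulr1.
Qed.
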